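(* Let $n\ge2$ and $s\in\left(\frac{n-1}{2},n-1\right)$. Then there exists an open set $\Omega\subset\mathbb{H}^n$ whose asymptotic boundary $\partial_\infty\Omega$ has Hausdorff dimension $s$ and which admits a bounded $\lambda_1$-harmonic function, i.e. a nontrivial bounded $u\in C(\overline\Omega)\cap C^2(\Omega)$ with $-\Delta u=\frac{(n-1)^2}{4}u$ in $\Omega$ and $u=0$ on $\partial\Omega$.
   Context: $\mathbb{H}^n$ is hyperbolic space with Laplace–Beltrami operator $\Delta$. $\partial_\infty\mathbb{H}^n$ is the set of classes of geodesic rays at bounded distance, with the cone topology; $\partial_\infty\Omega$ is the boundary of $\Omega$ in $\mathbb{H}^n\cup\partial_\infty\mathbb{H}^n$ minus its boundary in $\mathbb{H}^n$. The Hausdorff dimension of a subset of $\partial_\infty\mathbb{H}^n$ is that of its image on the unit sphere $\partial B\subset\mathbb{R}^n$ under the identification given by a Poincaré ball model (independent of the model). *)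

(* Defs.v *)
(* classical reals. Hyperbolic space H^n is realised as the
   Poincare ball model B = {x in R^n : |x| < 1}.  Points of R^n are encoded as
   functions nat -> R whose coordinates of index >= n vanish. *)
From Stdlib Require Import Reals.
Open Scope R_scope.

Fixpoint sumR (n : nat) (f : nat -> R) : R :=
  match n with O => 0 | S m => sumR m f + f m end.

Definition pt := nat -> R.

Definition InR (n : nat) (x : pt) : Prop := forall i, (n <= i)%nat -> x i = 0.

Definition normsq (n : nat) (x : pt) : R := sumR n (fun i => x i * x i).

Definition dist (n : nat) (x y : pt) : R := sqrt (normsq n (fun i => x i - y i)).

(* the Poincare ball (= H^n) and its boundary sphere (= boundary at infinity) *)
Definition Ball (n : nat) (x : pt) : Prop := InR n x /\ normsq n x < 1.
Definition Sphere (n : nat) (x : pt) : Prop := InR n x /\ normsq n x = 1.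

Definition closure_pt (n : nat) (A : pt -> Prop) (x : pt) : Prop :=
  InR n x /\ forall r, 0 < r -> exists y, A y /\ dist n x y < r.

(* A is open in H^n (cone/manifold topology = Euclidean topology on B) *)
Definition open_in_H (n : nat) (A : pt -> Prop) : Prop :=
  (forall x, A x -> Ball n x) /\
  forall x, A x -> exists r, 0 < r /\
    forall y, InR n y -> dist n x y < r -> A y.

Definition closure_H (n : nat) (A : pt -> Prop) (x : pt) : Prop :=
  Ball n x /\ closure_pt n A x.

Definition boundary_H (n : nat) (A : pt -> Prop) (x : pt) : Prop :=
  closure_H n A x /\ ~ A x.

Definition asymp_boundary (n : nat) (A : pt -> Prop) (x : pt) : Prop :=
  Sphere n x /\ closure_pt n A x.

Definition continuous_on (n : nat) (A : pt -> Prop) (f : pt -> R) : Prop :=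
  forall x, A x -> forall eps, 0 < eps -> exists delta, 0 < delta /\
    forall y, A y -> dist n x y < delta -> Rabs (f y - f x) < eps.

Definition shift (x : pt) (i : nat) (t : R) : pt :=
  fun k => if Nat.eqb k i then x k + t else x k.

Definition has_partial (f : pt -> R) (i : nat) (x : pt) (l : R) : Prop :=
  derivable_pt_lim (fun t => f (shift x i t)) 0 l.

Definition C2_on (n : nat) (A : pt -> Prop) (f : pt -> R)
  (D1 : nat -> pt -> R) (D2 : nat -> nat -> pt -> R) : Prop :=
  (forall i, (i < n)%nat -> forall x, A x -> has_partial f i x (D1 i x)) /\
  (forall i j, (i < n)%nat -> (j < n)%nat -> forall x, A x ->
      has_partial (D1 i) j x (D2 i j x)) /\
  continuous_on n A f /\
  (forall i, (i < n)%nat -> continuous_on n A (D1 i)) /\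
  (forall i j, (i < n)%nat -> (j < n)%nat -> continuous_on n A (D2 i j)).

(* Laplace-Beltrami operator of H^n in the Poincare ball model
   (metric 4|dx|^2/(1-|x|^2)^2):
   Delta u = (1-|x|^2)^2/4 * Delta_E u + (n-2)(1-|x|^2)/2 * x . grad u *)
Definition hyp_laplacian (n : nat) (D1 : nat -> pt -> R)
  (D2 : nat -> nat -> pt -> R) (x : pt) : R :=
  let w := 1 - normsq n x in
  (w * w / 4) * sumR n (fun i => D2 i i x)
  + (INR n - 2) * (w / 2) * sumR n (fun i => x i * D1 i x).

Definition hausdorff_null (n : nat) (s : R) (E : pt -> Prop) : Prop :=
  forall eps, 0 < eps -> exists (U : nat -> pt -> Prop) (d : nat -> R),
    (forall k, 0 < d k) /\
    (forall k x y, U k x -> U k y -> dist n x y <= d k) /\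
    (forall x, E x -> exists k, U k x) /\
    (forall N, sum_f_R0 (fun k => Rpower (d k) s) N <= eps).

Definition hausdorff_dim (n : nat) (E : pt -> Prop) (s : R) : Prop :=
  (forall t, 0 <= t -> hausdorff_null n t E -> s <= t) /\
  (forall b, (forall t, 0 <= t -> hausdorff_null n t E -> b <= t) -> b <= s).

(* Main.v *)
(* Let nu be the uniform measure on a self-similar Cantor set K of dimension s in the sphere, and
   P(x, xi) = (1 - |x|^2) / |x - xi|^2 the Poisson kernel of the ball. Since h = (n-1)/2 is a double
   root of the indicial equation a (n-1-a) = (n-1)^2/4, both P^h and P^h ln P are
   lambda_1-harmonic, hence so is
     u(x) = int P(x, xi)^h (ln P(x, xi) + kap) dnu(xi).
   As kap^-1 (ln P + kap) <= P^(1/kap), u is bounded above by a multiple of int P^a dnu with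
   a = h + 1/kap, and this is bounded when a < s because a ball of radius r has nu-measure O(r^s).
   On the other hand P tends to 0 at the points of the sphere outside K, where ln P + kap is
   therefore negative; thus {u > 0} accumulates at infinity only at K, and the positive part of u
   is the required function. *)
From Stdlib Require Import Reals Lra Lia Psatz Arith FunctionalExtensionality ClassicalEpsilon.
From Coquelicot Require Import Coquelicot.
Require Import Defs.
Open Scope R_scope.

(** * Finite sums and the Euclidean distance *)

(** The integral of P^h alone is positive on the whole ball, so only the logarithmic term can
    produce a proper domain. It comes from differentiating P^a in the exponent at a = h: since Delta
    P^a = - a (n-1-a) P^a, the derivative of the eigenvalue vanishes exactly at the double root. The
    two bounds on s enter separately. s > h leaves room for an exponent strictly between h and s; s
    < n-1 makes the contraction ratio lam, with lam^s = 1/2, satisfy lam^(n-1) < 1/2, so that the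
    pieces of the Cantor set are disjoint. nu is the image of the fair coin measure on bit streams,
    and all integrands are continuous there. Integrals are therefore limits of averages over finite
    prefixes, and compactness of the stream space, in the form of a branch argument on the binary
    tree, supplies the uniformity needed to differentiate under the integral. Points where u > 0 can
    accumulate at infinity only at K; that every point of K is reached is arranged by enlarging the
    domain, not by a lower bound for u. *)

Lemma sumR_ext (n : nat) (f g : nat -> R) :
  (forall i, (i < n)%nat -> f i = g i) -> sumR n f = sumR n g.
Proof.
  induction n as [|n IH]; intros H; simpl; [reflexivity|].
  rewrite IH by (intros; apply H; lia). now rewrite H by lia.
Qed.

Lemma sumR_le (n : nat) (f g : nat -> R) :
  (forall i, (i < n)%nat -> f i <= g i) -> sumR n f <= sumR n g.
Proof.
  induction n as [|n IH]; intros H; simpl; [lra|].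
  apply Rplus_le_compat; [apply IH; intros; apply H; lia|apply H; lia].
Qed.

Lemma sumR_plus (n : nat) (f g : nat -> R) :
  sumR n (fun i => f i + g i) = sumR n f + sumR n g.
Proof. induction n as [|n IH]; simpl; [ring|rewrite IH; ring]. Qed.

Lemma sumR_scal (n : nat) (c : R) (f : nat -> R) :
  sumR n (fun i => c * f i) = c * sumR n f.
Proof. induction n as [|n IH]; simpl; [ring|rewrite IH; ring]. Qed.

Lemma sumR_const (n : nat) (c : R) : sumR n (fun _ => c) = INR n * c.
Proof. induction n as [|n IH]; [simpl; ring|rewrite S_INR; simpl; rewrite IH; ring]. Qed.

Lemma sumR_ge0 (n : nat) (f : nat -> R) :
  (forall i, (i < n)%nat -> 0 <= f i) -> 0 <= sumR n f.
Proof.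
  intros H. replace 0 with (sumR n (fun _ => 0)) by (rewrite sumR_const; ring).
  now apply sumR_le.
Qed.

Lemma sumR_ge_term (n : nat) (f : nat -> R) (i : nat) :
  (forall i, (i < n)%nat -> 0 <= f i) -> (i < n)%nat -> f i <= sumR n f.
Proof.
  induction n as [|n IH]; intros H Hi; [lia|]. simpl.
  destruct (Nat.eq_dec i n) as [->|Hne].
  - assert (0 <= sumR n f) by (apply sumR_ge0; intros; apply H; lia). lra.
  - assert (f i <= sumR n f) by (apply IH; [intros; apply H; lia|lia]).
    assert (0 <= f n) by (apply H; lia). lra.
Qed.

Lemma sumR_update (n i : nat) (f g : nat -> R) :
  (i < n)%nat -> (forall k, k <> i -> f k = g k) ->
  sumR n f = sumR n g + (f i - g i).
Proof.
  induction n as [|n IH]; intros Hi H; [lia|]. simpl.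
  destruct (Nat.eq_dec i n) as [->|Hne].
  - rewrite (sumR_ext n f g) by (intros; apply H; lia). ring.
  - rewrite IH, (H n) by (lia || auto). ring.
Qed.

Lemma normsq_ge0 (n : nat) (x : pt) : 0 <= normsq n x.
Proof. apply sumR_ge0; intros; nra. Qed.

Lemma Cauchy_Schwarz (n : nat) (f g : nat -> R) :
  Rabs (sumR n (fun i => f i * g i)) <= sqrt (normsq n f) * sqrt (normsq n g).
Proof.
  rewrite <- sqrt_mult by apply normsq_ge0. rewrite <- sqrt_Rsqr_abs.
  apply sqrt_le_1_alt. unfold Rsqr, normsq.
  induction n as [|n IH]; simpl; [lra|].
  pose proof (normsq_ge0 n f) as HA. pose proof (normsq_ge0 n g) as HB. unfold normsq in *.
  set (A := sumR n (fun i => f i * f i)) in *. set (B := sumR n (fun i => g i * g i)) in *.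
  (* The inequality [H] controls the cross term of (A + a^2)(B + b^2) - (S + ab)^2. Squared, it
     follows from S^2 <= AB and from 4uv <= (u + v)^2 with u = A b^2, v = B a^2. *)
  set (S := sumR n (fun i => f i * g i)) in *. set (a := f n). set (b := g n).
  assert (H : 2 * S * (a * b) <= A * (b * b) + B * (a * a)).
  { apply Rle_trans with (Rabs (2 * S * (a * b))); [apply Rle_abs|].
    apply Rsqr_incr_0_var; [|nra].
    rewrite <- Rsqr_abs. unfold Rsqr.
    assert (S * S * (4 * (a * b) * (a * b)) <= A * B * (4 * (a * b) * (a * b)))
      by (apply Rmult_le_compat_r; nra).
    pose proof (Rle_0_sqr (A * (b * b) - B * (a * a))). unfold Rsqr in *. nra. }
  nra.
Qed.

Lemma dist_ge0 (n : nat) (x y : pt) : 0 <= dist n x y.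
Proof. apply sqrt_pos. Qed.

Lemma dist_sqr (n : nat) (x y : pt) :
  dist n x y * dist n x y = normsq n (fun i => x i - y i).
Proof. apply sqrt_sqrt, normsq_ge0. Qed.

Lemma dist_sym (n : nat) (x y : pt) : dist n x y = dist n y x.
Proof. unfold dist, normsq. f_equal. apply sumR_ext; intros; ring. Qed.

Lemma dist_refl (n : nat) (x : pt) : dist n x x = 0.
Proof.
  unfold dist, normsq. rewrite (sumR_ext n _ (fun _ => 0)) by (intros; ring).
  rewrite sumR_const, Rmult_0_r. apply sqrt_0.
Qed.

Lemma dist_triangle (n : nat) (x y z : pt) : dist n x z <= dist n x y + dist n y z.
Proof.
  apply Rsqr_incr_0_var;
    [|pose proof (dist_ge0 n x y); pose proof (dist_ge0 n y z); lra].
  unfold Rsqr. rewrite dist_sqr.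
  pose proof (Cauchy_Schwarz n (fun i => x i - y i) (fun i => y i - z i)) as H.
  fold (dist n x y) in H. fold (dist n y z) in H.
  apply Rle_trans with (1 := Rle_abs _) in H.
  replace (normsq n (fun i => x i - z i)) with
    (normsq n (fun i => x i - y i) + normsq n (fun i => y i - z i)
     + 2 * sumR n (fun i => (x i - y i) * (y i - z i))).
  - rewrite <- !dist_sqr. nra.
  - unfold normsq. rewrite <- sumR_scal, <- !sumR_plus. apply sumR_ext; intros; ring.
Qed.

Lemma coord_le_dist (n i : nat) (x y : pt) : (i < n)%nat -> Rabs (x i - y i) <= dist n x y.
Proof.
  intros Hi. rewrite <- sqrt_Rsqr_abs. apply sqrt_le_1_alt. unfold Rsqr.
  apply (sumR_ge_term n (fun i => (x i - y i) * (x i - y i))); [intros; apply Rle_0_sqr|easy].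
Qed.

Lemma dist_le_sum (n : nat) (x y : pt) : dist n x y <= sumR n (fun i => Rabs (x i - y i)).
Proof.
  apply Rsqr_incr_0_var; [|apply sumR_ge0; intros; apply Rabs_pos].
  unfold Rsqr. rewrite dist_sqr. unfold normsq.
  induction n as [|n IH]; simpl; [lra|].
  assert (0 <= sumR n (fun i => Rabs (x i - y i))) by (apply sumR_ge0; intros; apply Rabs_pos).
  pose proof (Rabs_pos (x n - y n)).
  replace ((x n - y n) * (x n - y n)) with (Rabs (x n - y n) * Rabs (x n - y n))
    by (rewrite <- Rabs_mult; apply Rabs_pos_eq, Rle_0_sqr).
  nra.
Qed.

(** Factor 1 - |x|^2 = (1 - |x|)(1 + |x|) and use 1 - |x| <= |x - xi|. All later bounds on the
    Poisson kernel rest on this. *)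
Lemma dist_Sphere_ge (n : nat) (x xi : pt) :
  normsq n x <= 1 -> Sphere n xi -> 1 - normsq n x <= 2 * dist n x xi.
Proof.
  intros Hx [_ Hxi].
  pose proof (dist_triangle n xi x (fun _ => 0)) as H.
  assert (Hd : forall y, dist n y (fun _ => 0) = sqrt (normsq n y)).
  { intros y. unfold dist, normsq. f_equal. apply sumR_ext; intros; ring. }
  rewrite !Hd, Hxi, sqrt_1, (dist_sym n xi x) in H.
  pose proof (normsq_ge0 n x) as H0. pose proof (sqrt_sqrt _ H0). pose proof (sqrt_pos (normsq n x)).
  assert (sqrt (normsq n x) <= 1) by (rewrite <- sqrt_1; now apply sqrt_le_1_alt).
  nra.
Qed.

Lemma InR_shift (n i : nat) (x : pt) (t : R) : (i < n)%nat -> InR n x -> InR n (shift x i t).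
Proof.
  intros Hi Hx k Hk. unfold shift. destruct (Nat.eqb_spec k i); [lia|]. now apply Hx.
Qed.

Lemma shift_shift (x : pt) (i : nat) (t r : R) : shift (shift x i t) i r = shift x i (t + r).
Proof.
  apply functional_extensionality; intros k. unfold shift.
  destruct (Nat.eqb k i); ring.
Qed.

Lemma shift_0 (x : pt) (i : nat) : shift x i 0 = x.
Proof.
  apply functional_extensionality; intros k. unfold shift.
  destruct (Nat.eqb k i); ring.
Qed.

Lemma normsq_shift (n i : nat) (x y : pt) (t : R) : (i < n)%nat ->
  normsq n (fun k => shift x i t k - y k)
  = normsq n (fun k => x k - y k) + 2 * (x i - y i) * t + t * t.
Proof.
  intros Hi. unfold normsq.
  rewrite (sumR_update n i _ (fun k => (x k - y k) * (x k - y k)) Hi).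
  - unfold shift. rewrite Nat.eqb_refl. ring.
  - intros k Hk. unfold shift. destruct (Nat.eqb_spec k i); [easy|reflexivity].
Qed.

Lemma dist_shift (n i : nat) (x : pt) (t : R) : (i < n)%nat -> dist n x (shift x i t) = Rabs t.
Proof.
  intros Hi. rewrite dist_sym. unfold dist. rewrite normsq_shift by easy.
  rewrite <- sqrt_Rsqr_abs. f_equal. unfold Rsqr, normsq.
  rewrite (sumR_ext n _ (fun _ => 0)) by (intros; ring). rewrite sumR_const. ring.
Qed.

Lemma Ball_open (n : nat) (x : pt) : Ball n x ->
  exists r, 0 < r /\ forall y, InR n y -> dist n x y < r -> Ball n y.
Proof.
  intros [_ Hx].
  set (m := sqrt (normsq n x)).
  assert (Hd : forall y, dist n y (fun _ => 0) = sqrt (normsq n y)).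
  { intros y. unfold dist, normsq. f_equal. apply sumR_ext; intros; ring. }
  assert (Hm : m < 1) by (unfold m; rewrite <- sqrt_1; apply sqrt_lt_1_alt; split; [apply normsq_ge0|easy]).
  exists (1 - m). split; [lra|]. intros y Hy Hxy. split; [easy|].
  pose proof (dist_triangle n y x (fun _ => 0)) as H.
  rewrite !Hd, (dist_sym n y x) in H. fold m in H.
  assert (H1 : sqrt (normsq n y) < 1) by lra.
  pose proof (sqrt_sqrt _ (normsq_ge0 n y)). pose proof (sqrt_pos (normsq n y)). nra.
Qed.

(** * Bit streams and branches of the binary tree *)

Definition stream := nat -> bool.

Definition agree (m : nat) (b b' : stream) : Prop := forall j, (j < m)%nat -> b j = b' j.

Definition scons (h : bool) (b : stream) : stream :=
  fun j => match j with O => h | S j => b j end.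

Definition upd (g : stream) (p : nat) (h : bool) : stream :=
  fun j => if Nat.eqb j p then h else g j.

Lemma agree_sym (m : nat) (b b' : stream) : agree m b b' -> agree m b' b.
Proof. intros H j Hj. symmetry. now apply H. Qed.

Lemma agree_trans (m : nat) (a b c : stream) : agree m a b -> agree m b c -> agree m a c.
Proof. intros H H' j Hj. now rewrite H, H'. Qed.

Lemma agree_le (m p : nat) (b b' : stream) : (m <= p)%nat -> agree p b b' -> agree m b b'.
Proof. intros Hm H j Hj. apply H. lia. Qed.

Lemma agree_scons (m : nat) (h : bool) (b b' : stream) :
  agree m b b' -> agree (S m) (scons h b) (scons h b').
Proof. intros H [|j] Hj; simpl; [reflexivity|apply H; lia]. Qed.

Lemma agree_upd (p : nat) (h : bool) (g : stream) : agree p (upd g p h) g.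
Proof. intros j Hj. unfold upd. destruct (Nat.eqb_spec j p); [lia|reflexivity]. Qed.

Lemma agree_S_upd (p : nat) (g b : stream) :
  agree p g b -> agree (S p) (upd g p (b p)) b.
Proof.
  intros H j Hj. unfold upd. destruct (Nat.eqb_spec j p) as [->|]; [easy|apply H; lia].
Qed.

Lemma agree_or_first_diff (T : nat) (b b' : stream) :
  agree T b b' \/ exists m, (m < T)%nat /\ agree m b b' /\ b m <> b' m.
Proof.
  induction T as [|T [IH|[m (Hm & H)]]]; [left; intros j; lia| |right; exists m; split; [lia|easy]].
  destruct (Bool.bool_dec (b T) (b' T)) as [E|E].
  - left. intros j Hj. destruct (Nat.eq_dec j T) as [->|]; [easy|apply IH; lia].
  - right. exists T. auto.
Qed.

(** Dependent choice along the binary tree: if a property of prefixes always survives one more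
    suitable bit, it holds along a whole branch. The last premise says that [P p] looks only at the
    first p bits. It replaces both a measure argument ([cylinders_not_cover]) and a compactness
    argument ([jcont_uniform]). *)
Lemma branch_exists (P : nat -> stream -> Prop) (g0 : stream) :
  P O g0 -> (forall p g, P p g -> exists h, P (S p) (upd g p h)) ->
  (forall p g g', agree p g g' -> P p g -> P p g') ->
  exists g, forall p, P p g.
Proof.
  intros H0 HS Hext.
  set (nxt := fun p (s : {g | P p g}) =>
    let (h, Hh) := constructive_indefinite_description _ (HS p (proj1_sig s) (proj2_sig s)) in
    exist (P (S p)) (upd (proj1_sig s) p h) Hh).
  set (st := fix st p : {g | P p g} :=
    match p with O => exist (P O) g0 H0 | S p => nxt p (st p) end).
  assert (Hag : forall p, agree p (proj1_sig (st (S p))) (proj1_sig (st p))).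
  { intros p. simpl. unfold nxt at 1.
    destruct constructive_indefinite_description as [h Hh]. simpl. apply agree_upd. }
  (* Bit p is read from stage p + 1, which has just fixed it; later stages leave it alone. *)
  exists (fun p => proj1_sig (st (S p)) p). intros p.
  apply Hext with (proj1_sig (st p)); [|exact (proj2_sig (st p))].
  induction p as [|p IH]; [intros j; lia|].
  intros j Hj. destruct (Nat.eq_dec j p) as [->|]; [reflexivity|].
  rewrite (Hag p) by lia. apply IH. lia.
Qed.

(** * The uniform measure on bit streams *)

(** A Riemann sum for the fair coin measure: the 2^m prefixes of length m are each continued by
    [false]. *)
Fixpoint avg (m : nat) (f : stream -> R) : R :=
  match m with
  | O => f (fun _ => false)
  | S m => (avg m (fun b => f (scons false b)) + avg m (fun b => f (scons true b))) / 2
  end.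

Lemma avg_le (m : nat) (f g : stream -> R) : (forall b, f b <= g b) -> avg m f <= avg m g.
Proof.
  revert f g. induction m as [|m IH]; intros f g H; simpl; [apply H|].
  pose proof (IH (fun b => f (scons false b)) (fun b => g (scons false b)) ltac:(intros; apply H)).
  pose proof (IH (fun b => f (scons true b)) (fun b => g (scons true b)) ltac:(intros; apply H)).
  lra.
Qed.

Lemma avg_lin (m : nat) (a c : R) (f g : stream -> R) :
  avg m (fun b => a * f b + c * g b) = a * avg m f + c * avg m g.
Proof.
  revert f g. induction m as [|m IH]; intros f g; simpl; [ring|]. rewrite !IH. field.
Qed.

Lemma avg_const (m : nat) (c : R) : avg m (fun _ => c) = c.
Proof. induction m as [|m IH]; simpl; [reflexivity|rewrite IH; field]. Qed.

Lemma avg_close (m p : nat) (f : stream -> R) (eps : R) :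
  (forall b b', agree m b b' -> Rabs (f b - f b') <= eps) ->
  Rabs (avg (m + p) f - avg m f) <= eps.
Proof.
  revert f. induction m as [|m IH]; intros f H; simpl.
  - set (z := fun _ : nat => false). apply Rabs_le. split.
    + assert (f z - eps <= avg p f).
      { rewrite <- (avg_const p (f z - eps)). apply avg_le. intros b.
        pose proof (H b z ltac:(intros j; lia)) as Hb. apply Rabs_le_between in Hb. lra. }
      lra.
    + assert (avg p f <= f z + eps).
      { rewrite <- (avg_const p (f z + eps)). apply avg_le. intros b.
        pose proof (H b z ltac:(intros j; lia)) as Hb. apply Rabs_le_between in Hb. lra. }
      lra.
  - pose proof (IH (fun b => f (scons false b))
      ltac:(intros; apply H; now apply agree_scons)) as H0.
    pose proof (IH (fun b => f (scons true b))
      ltac:(intros; apply H; now apply agree_scons)) as H1.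
    apply Rabs_le_between in H0. apply Rabs_le_between in H1. apply Rabs_le. lra.
Qed.

Definition ucont (f : stream -> R) : Prop :=
  forall eps, 0 < eps -> exists m, forall b b', agree m b b' -> Rabs (f b - f b') < eps.

(** The integral against the fair coin measure. It is meaningful where the limit exists, which
    [ucont] guarantees; hence that hypothesis in the lemmas below. *)
Definition mean (f : stream -> R) : R := real (Lim_seq (fun m => avg m f)).

Lemma is_lim_avg (f : stream -> R) : ucont f -> is_lim_seq (fun m => avg m f) (mean f).
Proof.
  intros Hf. apply Lim_seq_correct', ex_lim_seq_cauchy_corr. intros eps.
  destruct (Hf (eps / 4)) as [m Hm]; [destruct eps as [e He]; simpl; lra|].
  exists m. intros p q Hp Hq.
  assert (H : forall p, (m <= p)%nat -> Rabs (avg p f - avg m f) <= eps / 4).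
  { intros k Hk. replace k with (m + (k - m))%nat by lia. apply avg_close.
    intros b b' Hb. left. now apply Hm. }
  pose proof (H p Hp) as H1. pose proof (H q Hq) as H2.
  apply Rabs_le_between in H1. apply Rabs_le_between in H2.
  destruct eps as [e He]; simpl in *. apply Rabs_def1; lra.
Qed.

Lemma ucont_lin (a c : R) (f g : stream -> R) :
  ucont f -> ucont g -> ucont (fun b => a * f b + c * g b).
Proof.
  intros Hf Hg eps He.
  set (M := Rabs a + Rabs c + 1).
  assert (HM : 0 < M) by (pose proof (Rabs_pos a); pose proof (Rabs_pos c); unfold M; lra).
  destruct (Hf (eps / M)) as [m Hm]; [now apply Rdiv_lt_0_compat|].
  destruct (Hg (eps / M)) as [p Hp]; [now apply Rdiv_lt_0_compat|].
  exists (max m p). intros b b' Hb.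
  specialize (Hm b b' (agree_le _ _ _ _ (Nat.le_max_l m p) Hb)).
  specialize (Hp b b' (agree_le _ _ _ _ (Nat.le_max_r m p) Hb)).
  replace (_ - _) with (a * (f b - f b') + c * (g b - g b')) by ring.
  eapply Rle_lt_trans; [apply Rabs_triang|]. rewrite !Rabs_mult.
  pose proof (Rabs_pos a); pose proof (Rabs_pos c).
  assert (0 < eps / M) by now apply Rdiv_lt_0_compat.
  apply Rle_lt_trans with (Rabs a * (eps / M) + Rabs c * (eps / M)).
  - apply Rplus_le_compat; apply Rmult_le_compat_l; lra.
  - replace eps with (M * (eps / M)) at 3 by (field; lra). unfold M at 3. nra.
Qed.

Lemma ucont_const (c : R) : ucont (fun _ => c).
Proof. intros eps He. exists O. intros. rewrite Rminus_diag, Rabs_R0. exact He. Qed.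

Lemma ucont_sumR (n : nat) (g : nat -> stream -> R) :
  (forall i, (i < n)%nat -> ucont (g i)) -> ucont (fun b => sumR n (fun i => g i b)).
Proof.
  induction n as [|n IH]; intros H; simpl; [apply ucont_const|].
  intros eps He.
  destruct (ucont_lin 1 1 _ (g n) (IH ltac:(intros; apply H; lia)) ltac:(apply H; lia) eps He)
    as [m Hm].
  exists m. intros b b' Hb. specialize (Hm b b' Hb). cbv beta in Hm. now rewrite !Rmult_1_l in Hm.
Qed.

Lemma mean_lin (a c : R) (f g : stream -> R) : ucont f -> ucont g ->
  mean (fun b => a * f b + c * g b) = a * mean f + c * mean g.
Proof.
  intros Hf Hg. unfold mean at 1.
  rewrite (is_lim_seq_unique _ (a * mean f + c * mean g)); [reflexivity|].
  apply is_lim_seq_ext with (fun m => a * avg m f + c * avg m g).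
  { intros m. symmetry. apply avg_lin. }
  apply is_lim_seq_plus'; apply (is_lim_seq_scal_l _ _ (Finite _)); now apply is_lim_avg.
Qed.

Lemma mean_const (c : R) : mean (fun _ => c) = c.
Proof.
  unfold mean. rewrite (Lim_seq_ext _ (fun _ => c) (fun m => avg_const m c)). now rewrite Lim_seq_const.
Qed.

Lemma mean_sumR (n : nat) (g : nat -> stream -> R) : (forall i, (i < n)%nat -> ucont (g i)) ->
  mean (fun b => sumR n (fun i => g i b)) = sumR n (fun i => mean (g i)).
Proof.
  induction n as [|n IH]; intros H; simpl; [apply mean_const|].
  replace (fun b => _) with (fun b => 1 * sumR n (fun i => g i b) + 1 * g n b)
    by (apply functional_extensionality; intros; ring).
  rewrite mean_lin, IH; [ring| | |]; try (intros; apply H; lia).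
  apply ucont_sumR. intros; apply H; lia.
Qed.

(** Only large depths are required because the majorant of the potential can be averaged only at
    depths beyond its own truncation. *)
Lemma mean_le_eventually (f : stream -> R) (c : R) (m : nat) : ucont f ->
  (forall p, (m <= p)%nat -> avg p f <= c) -> mean f <= c.
Proof.
  intros Hf H.
  apply (is_lim_seq_le_loc (fun p => avg p f) (fun _ => c) (mean f) c).
  - exists m. exact H.
  - now apply is_lim_avg.
  - apply is_lim_seq_const.
Qed.

Lemma mean_le_const (f : stream -> R) (c : R) : ucont f -> (forall b, f b <= c) -> mean f <= c.
Proof.
  intros Hf H. apply (mean_le_eventually f c O Hf). intros p _.
  rewrite <- (avg_const p c). now apply avg_le.
Qed.

Lemma mean_abs_le (f : stream -> R) (c : R) : ucont f -> (forall b, Rabs (f b) <= c) -> Rabs (mean f) <= c.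
Proof.
  intros Hf H. apply Rabs_le. split.
  (* The vanishing second term puts a scalar multiple into the two-term shape of [mean_lin]; the
     same device recurs below. *)
  - assert (E : mean (fun b => -1 * f b + 0 * f b) <= c).
    { apply mean_le_const; [now apply ucont_lin|]. intros b.
      pose proof (H b) as Hb. apply Rabs_le_between in Hb. lra. }
    rewrite mean_lin in E by easy. lra.
  - apply mean_le_const; [easy|]. intros b. pose proof (H b) as Hb. apply Rabs_le_between in Hb. lra.
Qed.

(** * Cylinders of total mass less than one do not cover the space of streams *)

(* The conditional probability of the cylinder [agree l b], given the first p bits of g. *)
Definition cond_mass (l : nat) (b : stream) (p : nat) (g : stream) : R :=
  if excluded_middle_informative (agree (min l p) b g) then (1 / 2) ^ (l - p) else 0.

Lemma cond_mass_ge0 (l : nat) (b : stream) (p : nat) (g : stream) : 0 <= cond_mass l b p g.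
Proof.
  unfold cond_mass. destruct excluded_middle_informative; [apply pow_le|]; lra.
Qed.

Lemma cond_mass_ext (l : nat) (b : stream) (p : nat) (g g' : stream) :
  agree p g g' -> cond_mass l b p g = cond_mass l b p g'.
Proof.
  intros H. unfold cond_mass.
  assert (H' : agree (min l p) g g') by (apply agree_le with (2 := H); lia).
  destruct excluded_middle_informative as [A|A], excluded_middle_informative as [B|B];
    try reflexivity; exfalso.
  - apply B. eapply agree_trans; eauto.
  - apply A. eapply agree_trans; [eauto|now apply agree_sym].
Qed.

(** The martingale property for a uniform next bit. If l <= p the cylinder is already decided;
    otherwise at most one of the two bits stays inside it, and its conditional mass doubles. *)
Lemma cond_mass_split (l : nat) (b : stream) (p : nat) (g : stream) :
  cond_mass l b p g
  = (cond_mass l b (S p) (upd g p false) + cond_mass l b (S p) (upd g p true)) / 2.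
Proof.
  destruct (Nat.le_gt_cases l p) as [Hl|Hl].
  - assert (E : forall h, cond_mass l b (S p) (upd g p h) = cond_mass l b p g).
    { intros h. rewrite <- (cond_mass_ext l b p (upd g p h) g) by apply agree_upd.
      unfold cond_mass. rewrite !Nat.min_l by lia.
      replace (l - S p)%nat with (l - p)%nat by lia. reflexivity. }
    rewrite !E. field.
  - unfold cond_mass. rewrite !Nat.min_r by lia.
    destruct excluded_middle_informative as [A|A].
    + assert (Hh : forall h, agree (S p) b (upd g p h) <-> h = b p).
      { intros h. split.
        - intros H. rewrite (H p) by lia. unfold upd. now rewrite Nat.eqb_refl.
        - intros ->. apply agree_sym, agree_S_upd, agree_sym, A. }
      replace (l - p)%nat with (S (l - S p)) by lia. simpl pow.
      destruct (excluded_middle_informative (agree (S p) b (upd g p false))) as [B|B];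
      destruct (excluded_middle_informative (agree (S p) b (upd g p true))) as [C'|C'];
      rewrite Hh in B, C'; destruct (b p); try congruence; try field.
    + assert (Hh : forall h, ~ agree (S p) b (upd g p h)).
      { intros h H. apply A. apply agree_trans with (upd g p h); [|apply agree_upd].
        apply agree_le with (2 := H). lia. }
      destruct (excluded_middle_informative (agree (S p) b (upd g p false))) as [B|B];
        [now apply Hh in B|].
      destruct (excluded_middle_informative (agree (S p) b (upd g p true))) as [C'|C'];
        [now apply Hh in C'|]. field.
Qed.

Lemma sum_f_R0_ge_term (f : nat -> R) (k N : nat) :
  (forall k, 0 <= f k) -> (k <= N)%nat -> f k <= sum_f_R0 f N.
Proof.
  intros Hf. induction N as [|N IH]; intros Hk; simpl.
  - replace k with O by lia. lra.
  - destruct (Nat.eq_dec k (S N)) as [->|].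
    + pose proof (cond_pos_sum f N Hf). lra.
    + pose proof (Hf (S N)). assert (f k <= sum_f_R0 f N) by (apply IH; lia). lra.
Qed.

Lemma sum_f_R0_mono (f : nat -> R) (N M : nat) :
  (forall k, 0 <= f k) -> (N <= M)%nat -> sum_f_R0 f N <= sum_f_R0 f M.
Proof.
  intros Hf H. induction H as [|M H IH]; [lra|]. simpl. pose proof (Hf (S M)). lra.
Qed.

(** The method of conditional expectations. The total conditional mass is the average of its values
    after the two possible next bits, so one of them keeps it at most theta. Along the resulting
    branch g, a cylinder of length l containing g would have conditional mass 1 at depth l, more
    than theta. *)
Lemma cylinders_not_cover (l : nat -> nat) (b : nat -> stream) (theta : R) :
  theta < 1 -> (forall N, sum_f_R0 (fun k => (1 / 2) ^ l k) N <= theta) ->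
  exists g, forall k, ~ agree (l k) (b k) g.
Proof.
  intros Ht Hsum.
  destruct (branch_exists
    (fun p g => forall N, sum_f_R0 (fun k => cond_mass (l k) (b k) p g) N <= theta)
    (fun _ => false)) as [g Hg].
  - intros N. apply Rle_trans with (2 := Hsum N). apply sum_Rle. intros k _.
    unfold cond_mass. rewrite Nat.sub_0_r.
    destruct excluded_middle_informative; [lra|]. apply pow_le. lra.
  - intros p g Hg. apply NNPP. intros Hno.
    assert (Hbad : forall h, exists N,
      theta < sum_f_R0 (fun k => cond_mass (l k) (b k) (S p) (upd g p h)) N).
    { intros h. apply NNPP. intros H. apply Hno. exists h. intros N.
      apply Rnot_lt_le. intros H'. apply H. now exists N. }
    destruct (Hbad false) as [N0 H0], (Hbad true) as [N1 H1].
    (* Partial sums increase, so one index exhibits the excess for both bits, contradicting their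
       average. *)
    specialize (Hg (max N0 N1)).
    assert (E : sum_f_R0 (fun k => cond_mass (l k) (b k) p g) (max N0 N1) =
      (sum_f_R0 (fun k => cond_mass (l k) (b k) (S p) (upd g p false)) (max N0 N1) +
       sum_f_R0 (fun k => cond_mass (l k) (b k) (S p) (upd g p true)) (max N0 N1)) / 2).
    { generalize (max N0 N1). intros N.
      induction N as [|N IH]; simpl; rewrite ?IH, cond_mass_split; field. }
    pose proof (sum_f_R0_mono (fun k => cond_mass (l k) (b k) (S p) (upd g p false)) N0 (max N0 N1)
      ltac:(intros; apply cond_mass_ge0) (Nat.le_max_l _ _)).
    pose proof (sum_f_R0_mono (fun k => cond_mass (l k) (b k) (S p) (upd g p true)) N1 (max N0 N1)
      ltac:(intros; apply cond_mass_ge0) (Nat.le_max_r _ _)).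
    lra.
  - intros p g g' Ha Hg N. rewrite <- (sum_eq (fun k => cond_mass (l k) (b k) p g)); [apply Hg|].
    intros. now apply cond_mass_ext.
  - exists g. intros k Hk.
    specialize (Hg (l k) k).
    pose proof (sum_f_R0_ge_term (fun j => cond_mass (l j) (b j) (l k) g) k k
      ltac:(intros; apply cond_mass_ge0) (le_n k)) as H.
    cbv beta in H. unfold cond_mass at 1 in H.
    rewrite Nat.min_id, Nat.sub_diag in H.
    destruct excluded_middle_informative; [simpl in H; lra|easy].
Qed.

(** * Hausdorff dimension of Cantor sets *)

Lemma pow_small (x C eps : R) : 0 <= x < 1 -> 0 < C -> 0 < eps -> exists m, C * x ^ m < eps.
Proof.
  intros Hx HC He.
  destruct (pow_lt_1_zero x ltac:(rewrite Rabs_pos_eq; lra) (eps / C)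
    ltac:(now apply Rdiv_lt_0_compat)) as [m Hm].
  exists m. specialize (Hm m (le_n m)). rewrite Rabs_pos_eq in Hm by (apply pow_le; lra).
  apply Rmult_lt_compat_l with (r := C) in Hm; [|easy].
  replace (C * (eps / C)) with eps in Hm by (field; lra). exact Hm.
Qed.

Lemma Rpower_of_pow (x t : R) (m : nat) : 0 < x -> Rpower (x ^ m) t = Rpower x t ^ m.
Proof.
  intros Hx. rewrite <- (Rpower_pow m x), <- (Rpower_pow m (Rpower x t)) by (easy || apply exp_pos).
  rewrite !Rpower_mult. f_equal. ring.
Qed.

Lemma pow_antitone (x : R) (m p : nat) : 0 <= x <= 1 -> (m <= p)%nat -> x ^ p <= x ^ m.
Proof.
  intros Hx H. induction H as [|p H IH]; [lra|]. simpl. pose proof (pow_le x p ltac:(lra)). nra.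
Qed.

Lemma prefix_testbit (m : nat) (b : stream) :
  exists k, (k < 2 ^ m)%nat /\ agree m (Nat.testbit k) b.
Proof.
  revert b. induction m as [|m IH]; intros b; [exists O; split; [simpl; lia|intros j; lia]|].
  destruct (IH (fun j => b (S j))) as [k [Hk Ha]].
  exists (if b O then 2 * k + 1 else 2 * k)%nat.
  split; [simpl; destruct (b O); lia|].
  intros [|j] Hj; destruct (b O) eqn:E.
  - apply Nat.testbit_odd_0.
  - apply Nat.testbit_even_0.
  - rewrite Nat.testbit_odd_succ by lia. apply Ha. lia.
  - rewrite Nat.testbit_even_succ by lia. apply Ha. lia.
Qed.

(** A bi-Lipschitz parametrization for the ultrametric lam^m, m being the first index of
    disagreement. Together with lam^s = 1/2 this is all that is used about the Cantor set. *)
Definition cantor_param (n : nat) (lam c C : R) (xi : stream -> pt) : Prop :=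
  (forall b, Sphere n (xi b)) /\
  (forall m b b', agree m b b' -> dist n (xi b) (xi b') <= C * lam ^ m) /\
  (forall m b b', agree m b b' -> b m <> b' m -> c * lam ^ m <= dist n (xi b) (xi b')).

(** Membership in the closure of the Cantor set; the covering argument for the upper dimension bound
    works for the closure directly. *)
Definition near (n : nat) (xi : stream -> pt) (x : pt) : Prop :=
  forall eps, 0 < eps -> exists b, dist n x (xi b) < eps.

(** At depth m the 2^m cylinders have diameter of order lam^m, so the covering sum is a constant
    times (2 lam^t)^m, which tends to 0. *)
Lemma hausdorff_null_near (n : nat) (lam c C t : R) (xi : stream -> pt) (E : pt -> Prop) :
  cantor_param n lam c C xi -> 0 < lam -> 0 < C -> 0 < t -> 2 * Rpower lam t < 1 ->
  (forall x, E x -> near n xi x) -> hausdorff_null n t E.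
Proof.
  intros (_ & Hup & _) Hl HC Ht Hlt HE eps He.
  (* A cylinder has diameter at most C lam^m, and its neighbourhood of radius lam^m adds lam^m at
     either end. *)
  set (D := C + 2). set (q := 2 * Rpower lam t) in *.
  assert (Hq : 0 < q) by (unfold q, Rpower; pose proof (exp_pos (t * ln lam)); lra).
  destruct (pow_small q (Rpower D t) (eps / 2)) as [m Hm];
    [lra|apply exp_pos|lra|].
  assert (Hlm : 0 < lam ^ m) by now apply pow_lt.
  set (v := Rpower (D * lam ^ m) t).
  assert (Hv : 2 ^ m * v < eps / 2).
  { unfold v. rewrite <- Rpower_mult_distr by (unfold D; lra).
    rewrite Rpower_of_pow by easy.
    replace (2 ^ m * _) with (Rpower D t * (2 * Rpower lam t) ^ m) by (rewrite Rpow_mult_distr; ring).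
    exact Hm. }
  assert (He' : forall k, 0 < eps / 2 * (1 / 2) ^ S k)
    by (intros; apply Rmult_lt_0_compat; [lra|apply pow_lt; lra]).
  exists (fun k x => (k < 2 ^ m)%nat /\
    exists b, agree m (Nat.testbit k) b /\ dist n x (xi b) <= lam ^ m).
  (* [hausdorff_null] asks for a positive diameter at every index. The indices from 2^m on carry
     empty sets, with diameters whose t-th powers form a geometric series; these terms are kept
     below eps/2 in total. *)
  exists (fun k => if lt_dec k (2 ^ m) then D * lam ^ m
                   else Rpower (eps / 2 * (1 / 2) ^ S k) (/ t)).
  repeat split.
  - intros k. destruct lt_dec; [unfold D; nra|apply exp_pos].
  - intros k x y [Hk [b [Hb Hx]]] [_ [b' [Hb' Hy]]]. destruct lt_dec; [|easy].
    pose proof (dist_triangle n x (xi b) y). pose proof (dist_triangle n (xi b) (xi b') y).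
    rewrite (dist_sym n y) in Hy.
    pose proof (Hup m b b' (agree_trans _ _ _ _ (agree_sym _ _ _ Hb) Hb')). unfold D. lra.
  - intros x Hx. destruct (HE x Hx (lam ^ m) Hlm) as [b Hb].
    destruct (prefix_testbit m b) as [k [Hk Ha]]. exists k. split; [easy|].
    exists b. split; [easy|lra].
  - intros N.
    apply Rle_trans with (INR (min (S N) (2 ^ m)) * v + eps / 2 * (1 - (1 / 2) ^ S N)).
    + assert (Hstep : forall k, Rpower (if lt_dec k (2 ^ m) then D * lam ^ m
          else Rpower (eps / 2 * (1 / 2) ^ S k) (/ t)) t
          <= (if lt_dec k (2 ^ m) then v else 0) + eps / 2 * (1 / 2) ^ S k).
      { intros k. pose proof (He' k). destruct lt_dec; [unfold v; lra|].
        rewrite Rpower_mult, Rinv_l, Rpower_1 by lra. lra. }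
      assert (Hmin : forall k, INR (min k (2 ^ m)) * v + (if lt_dec k (2 ^ m) then v else 0)
          = INR (min (S k) (2 ^ m)) * v).
      { intros k. destruct lt_dec as [Hk|Hk].
        - rewrite !Nat.min_l, S_INR by lia. ring.
        - rewrite !Nat.min_r by lia. ring. }
      induction N as [|N IH].
      * pose proof (Hstep O). pose proof (Hmin O). rewrite <- Hmin.
        simpl INR. cbn [sum_f_R0]. rewrite Rmult_0_l. simpl pow in *. lra.
      * pose proof (Hstep (S N)). rewrite <- Hmin. cbn [sum_f_R0].
        replace (eps / 2 * (1 - (1 / 2) ^ S (S N)))
          with (eps / 2 * (1 - (1 / 2) ^ S N) + eps / 2 * (1 / 2) ^ S (S N)) by (simpl; field).
        lra.
    + assert (INR (min (S N) (2 ^ m)) <= 2 ^ m).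
      { replace (2 ^ m) with (INR (2 ^ m)) by (rewrite pow_INR; reflexivity). apply le_INR. lia. }
      assert (0 < v) by apply exp_pos.
      pose proof (pow_lt (1 / 2) (S N) ltac:(lra)). nra.
Qed.

(** Take the least m with c lam^m <= d. Two streams that differ before index m give points at
    distance at least c lam^(m-1) > d, so those in U share m bits; and 2^-m = (lam^m)^s <=
    (d/c)^s. *)
Lemma diam_in_cylinder (n : nat) (lam c C s d : R) (xi : stream -> pt) (U : pt -> Prop) :
  cantor_param n lam c C xi -> 0 < lam < 1 -> 0 < c -> 0 < s -> Rpower lam s = 1 / 2 ->
  0 < d -> (forall x y, U x -> U y -> dist n x y <= d) ->
  exists m g, (1 / 2) ^ m <= Rpower (d / c) s /\ forall b, U (xi b) -> agree m g b.
Proof.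
  intros (_ & _ & Hlo) Hlam Hc Hs Hls Hd HU.
  assert (Hm : exists m, c * lam ^ m <= d /\ (m = O \/ d < c * lam ^ (pred m))).
  { destruct (pow_small lam c d) as [m0 Hm0]; [lra|easy|easy|].
    induction m0 as [|m IH]; [exists O; split; [lra|now left]|].
    destruct (Rlt_or_le (c * lam ^ m) d) as [H|H]; [now apply IH|].
    destruct (Req_dec (c * lam ^ m) d) as [Heq|Hne].
    - destruct m as [|m]; [exists O; split; [lra|now left]|].
      exists (S m). split; [lra|right]. simpl in *.
      assert (0 < lam ^ m) by (apply pow_lt; lra). nra.
    - exists (S m). split; [lra|right; simpl; lra]. }
  destruct Hm as [m [Hm1 Hm2]].
  assert (Hmass : (1 / 2) ^ m <= Rpower (d / c) s).
  { rewrite <- Hls, <- Rpower_of_pow by lra.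
    apply Rle_Rpower_l; [lra|]. split; [apply pow_lt; lra|].
    apply Rmult_le_reg_l with c; [easy|]. replace (c * (d / c)) with d by (field; lra). exact Hm1. }
  destruct (classic (exists b0, U (xi b0))) as [[b0 Hb0]|Hno].
  - exists m, b0. split; [easy|]. intros b Hb.
    destruct (agree_or_first_diff m b0 b) as [H|[j (Hj & Ha & Hne)]]; [easy|exfalso].
    pose proof (Hlo j b0 b Ha Hne). pose proof (HU _ _ Hb0 Hb).
    destruct Hm2 as [->|Hm2]; [lia|].
    pose proof (pow_antitone lam j (pred m) ltac:(lra) ltac:(lia)). nra.
  - exists m, (fun _ => false). split; [easy|]. intros b Hb. exfalso. apply Hno. now exists b.
Qed.

(** The mass distribution principle: a cover with small t-sum yields cylinders of total mass at most
    1/2, which miss some stream. *)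
Lemma not_hausdorff_null_cantor (n : nat) (lam c C s t : R) (xi : stream -> pt) (E : pt -> Prop) :
  cantor_param n lam c C xi -> 0 < lam < 1 -> 0 < c -> 0 < s -> Rpower lam s = 1 / 2 ->
  0 <= t < s -> (forall b, E (xi b)) -> ~ hausdorff_null n t E.
Proof.
  intros Hxi Hlam Hc Hs Hls Ht HE Hnull.
  set (K := Rpower (/ c) s). assert (HK : 0 < K) by apply exp_pos.
  (* The bound 1/2 forces every d k < 1, whence (d k)^s <= (d k)^t; the bound 1/(2K) brings the
     total mass of the cylinders to at most 1/2. *)
  destruct (Hnull (Rmin (1 / 2) (1 / 2 / K))) as [U [d (Hd & HU & Hcov & Hsum)]].
  { apply Rmin_glb_lt; [lra|]. apply Rdiv_lt_0_compat; lra. }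
  assert (Hd1 : forall k, d k < 1).
  { intros k. apply Rnot_le_lt. intros H.
    pose proof (sum_f_R0_ge_term (fun k => Rpower (d k) t) k k
      ltac:(intros; left; apply exp_pos) (le_n k)) as H1.
    pose proof (Hsum k). pose proof (Rmin_l (1 / 2) (1 / 2 / K)).
    assert (1 <= Rpower (d k) t).
    { rewrite <- (Rpower_O (d k)) by apply Hd. apply Rle_Rpower; lra. }
    cbv beta in *. lra. }
  assert (Hcyl : forall k, exists p : nat * stream, (1 / 2) ^ fst p <= K * Rpower (d k) t /\
    forall b, U k (xi b) -> agree (fst p) (snd p) b).
  { intros k.
    destruct (diam_in_cylinder n lam c C s (d k) xi (U k)) as [m [g [Hm Hg]]]; auto.
    exists (m, g). split; [|exact Hg]. simpl. apply Rle_trans with (1 := Hm).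
    unfold Rdiv. rewrite <- Rpower_mult_distr by (apply Hd || now apply Rinv_0_lt_compat).
    fold K. rewrite Rmult_comm. apply Rmult_le_compat_l; [lra|].
    unfold Rpower. left. apply exp_increasing.
    assert (ln (d k) < 0) by (rewrite <- ln_1; apply ln_increasing; auto). nra. }
  set (p := fun k => proj1_sig (constructive_indefinite_description _ (Hcyl k))).
  assert (Hp : forall k, (1 / 2) ^ fst (p k) <= K * Rpower (d k) t /\
    forall b, U k (xi b) -> agree (fst (p k)) (snd (p k)) b).
  { intros k. apply (proj2_sig (constructive_indefinite_description _ (Hcyl k))). }
  destruct (cylinders_not_cover (fun k => fst (p k)) (fun k => snd (p k)) (1 / 2))
    as [g Hg]; [lra| |].
  - intros N. apply Rle_trans with (sum_f_R0 (fun k => Rpower (d k) t * K) N).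
    + apply sum_Rle. intros k _. rewrite Rmult_comm. apply Hp.
    + rewrite <- scal_sum.
      pose proof (Hsum N) as H. pose proof (Rmin_r (1 / 2) (1 / 2 / K)).
      apply Rle_trans with (K * (1 / 2 / K)); [|right; field; lra].
      apply Rmult_le_compat_l; lra.
  - destruct (Hcov (xi g) (HE g)) as [k Hk]. apply (Hg k). now apply Hp.
Qed.

Lemma hausdorff_dim_cantor (n : nat) (lam c C s : R) (xi : stream -> pt) (E : pt -> Prop) :
  cantor_param n lam c C xi -> 0 < lam < 1 -> 0 < c -> 0 < C -> 0 < s -> Rpower lam s = 1 / 2 ->
  (forall b, E (xi b)) -> (forall x, E x -> near n xi x) -> hausdorff_dim n E s.
Proof.
  intros Hxi Hlam Hc HC Hs Hls HK HE. split.
  - intros t Ht Hnull. apply Rnot_lt_le. intros Hts.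
    exact (not_hausdorff_null_cantor n lam c C s t xi E Hxi Hlam Hc Hs Hls (conj Ht Hts) HK Hnull).
  - intros a Ha. apply Rnot_lt_le. intros Hsa.
    (* If s < a, the midpoint t exceeds s, so 2 lam^t < 1 and the set is t-null, although t < a. *)
    assert (Hm : a <= (s + a) / 2); [|lra].
    apply Ha; [lra|].
    apply (hausdorff_null_near n lam c C _ xi E Hxi); try easy; try lra.
    assert (Rpower lam ((s + a) / 2) < 1 / 2); [|lra].
    rewrite <- Hls. unfold Rpower. apply exp_increasing.
    assert (ln lam < 0) by (rewrite <- ln_1; apply ln_increasing; lra). nra.
Qed.

(** * A Cantor set of dimension s on the sphere *)

Definition cantor_sum (rho : R) (b : stream) : R := Series (fun k => if b k then rho ^ k else 0).

Lemma ex_cantor_sum (rho : R) (b : stream) : 0 < rho < 1 ->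
  ex_series (fun k => if b k then rho ^ k else 0).
Proof.
  intros Hr. apply (@ex_series_le R_AbsRing R_CompleteNormedModule _ (fun k => rho ^ k)).
  - intros k. change (Rabs (if b k then rho ^ k else 0) <= rho ^ k).
    pose proof (pow_lt rho k ltac:(lra)). destruct (b k); rewrite Rabs_pos_eq; lra.
  - apply ex_series_geom. rewrite Rabs_pos_eq; lra.
Qed.

Lemma cantor_sum_range (rho : R) (b : stream) : 0 < rho < 1 ->
  0 <= cantor_sum rho b <= / (1 - rho).
Proof.
  intros Hr.
  assert (Hk : forall k, 0 <= (if b k then rho ^ k else 0) <= rho ^ k).
  { intros k. pose proof (pow_lt rho k ltac:(lra)). destruct (b k); lra. }
  split.
  - rewrite <- (Rmult_0_l (Series (fun _ => 0))), <- Series_scal_l.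
    unfold cantor_sum. apply Series_le; [|now apply ex_cantor_sum].
    intros k. rewrite Rmult_0_l. split; [lra|apply Hk].
  - rewrite <- Series_geom by (rewrite Rabs_pos_eq; lra).
    apply Series_le; [exact Hk|]. apply ex_series_geom. rewrite Rabs_pos_eq; lra.
Qed.

Lemma cantor_sum_step (rho : R) (b : stream) : 0 < rho < 1 ->
  cantor_sum rho b = (if b O then 1 else 0) + rho * cantor_sum rho (fun k => b (S k)).
Proof.
  intros Hr. unfold cantor_sum. rewrite Series_incr_1 by now apply ex_cantor_sum.
  rewrite <- Series_scal_l. simpl. f_equal. apply Series_ext. intros k.
  destruct (b (S k)); ring.
Qed.

Lemma cantor_sum_upper (rho : R) (k : nat) (b b' : stream) : 0 < rho < 1 -> agree k b b' ->
  Rabs (cantor_sum rho b - cantor_sum rho b') <= rho ^ k / (1 - rho).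
Proof.
  intros Hr. revert b b'. induction k as [|k IH]; intros b b' H.
  - pose proof (cantor_sum_range rho b Hr). pose proof (cantor_sum_range rho b' Hr).
    apply Rabs_le. simpl. lra.
  - rewrite (cantor_sum_step rho b), (cantor_sum_step rho b'), (H O) by (easy || lia).
    replace (_ - _) with (rho * (cantor_sum rho (fun k => b (S k)) - cantor_sum rho (fun k => b' (S k))))
      by ring.
    rewrite Rabs_mult, Rabs_pos_eq by lra. simpl.
    unfold Rdiv. rewrite Rmult_assoc. apply Rmult_le_compat_l; [lra|].
    apply IH. intros j Hj. apply H. lia.
Qed.

(** The first differing bit contributes rho^k, and the tails can cancel at most rho^(k+1)/(1 - rho)
    of it. The bound is positive precisely for rho < 1/2. *)
Lemma cantor_sum_lower (rho : R) (k : nat) (b b' : stream) : 0 < rho < 1 ->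
  agree k b b' -> b k <> b' k ->
  rho ^ k * ((1 - 2 * rho) / (1 - rho)) <= Rabs (cantor_sum rho b - cantor_sum rho b').
Proof.
  intros Hr. revert b b'. induction k as [|k IH]; intros b b' H Hne;
    rewrite (cantor_sum_step rho b), (cantor_sum_step rho b') by easy.
  - replace (_ * _) with (1 - rho * / (1 - rho)) by (simpl; field; lra).
    pose proof (cantor_sum_range rho (fun k => b (S k)) Hr) as H1.
    pose proof (cantor_sum_range rho (fun k => b' (S k)) Hr) as H2.
    set (u := cantor_sum rho (fun k => b (S k))) in *.
    set (u' := cantor_sum rho (fun k => b' (S k))) in *.
    assert (rho * u <= rho * / (1 - rho)) by (apply Rmult_le_compat_l; lra).
    assert (rho * u' <= rho * / (1 - rho)) by (apply Rmult_le_compat_l; lra).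
    assert (0 <= rho * u) by (apply Rmult_le_pos; lra).
    assert (0 <= rho * u') by (apply Rmult_le_pos; lra).
    destruct (b O), (b' O); try easy.
    + eapply Rle_trans; [|apply Rle_abs]. lra.
    + rewrite <- Rabs_Ropp. eapply Rle_trans; [|apply Rle_abs]. lra.
  - rewrite (H O) by lia.
    replace (_ + _ - _) with (rho * (cantor_sum rho (fun k => b (S k)) - cantor_sum rho (fun k => b' (S k))))
      by ring.
    rewrite Rabs_mult, (Rabs_pos_eq rho) by lra. simpl pow.
    rewrite Rmult_assoc. apply Rmult_le_compat_l; [lra|].
    apply IH; [|easy]. intros j Hj. apply H. lia.
Qed.

(* The bits of a stream are dealt out to the d = n - 1 free coordinates in turn, bit j being
   weighted by lam^j; the last coordinate puts the point on the sphere. *)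
Definition cantor_coord (d : nat) (lam : R) (b : stream) (i : nat) : R :=
  (1 - lam ^ d) / (2 * INR d) * lam ^ i * cantor_sum (lam ^ d) (fun k => b (i + k * d)%nat).

Definition cantor_pt (d : nat) (lam : R) (b : stream) : pt :=
  fun i => if lt_dec i d then cantor_coord d lam b i
           else if Nat.eq_dec i d then sqrt (1 - normsq d (cantor_coord d lam b)) else 0.

Lemma sqrt_lipschitz (A B : R) : 1 / 4 <= A -> 1 / 4 <= B -> Rabs (sqrt A - sqrt B) <= Rabs (A - B).
Proof.
  intros HA HB.
  assert (Hs : forall z, 1 / 4 <= z -> 1 / 2 <= sqrt z).
  { intros z Hz. rewrite <- (sqrt_pow2 (1 / 2)) by lra. apply sqrt_le_1_alt. lra. }
  pose proof (Hs A HA). pose proof (Hs B HB).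
  replace (A - B) with ((sqrt A - sqrt B) * (sqrt A + sqrt B)).
  - rewrite Rabs_mult, (Rabs_pos_eq (sqrt A + sqrt B)) by lra.
    pose proof (Rabs_pos (sqrt A - sqrt B)). nra.
  - replace A with (sqrt A * sqrt A) at 3 by (apply sqrt_sqrt; lra).
    replace B with (sqrt B * sqrt B) at 3 by (apply sqrt_sqrt; lra). ring.
Qed.

(** The factor 1 - lam^d normalizes the largest possible sum to 1. The factor 1/(2d) then bounds the
    squared norm of the free coordinates by 1/4, which keeps the last coordinate away from 0, where
    the square root is not Lipschitz. *)
Lemma cantor_coord_range (d : nat) (lam : R) (b : stream) (i : nat) :
  (1 <= d)%nat -> 0 < lam < 1 -> 0 <= cantor_coord d lam b i <= / (2 * INR d).
Proof.
  intros Hd Hl. apply le_INR in Hd. simpl in Hd.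
  assert (Hrho : 0 < lam ^ d < 1).
  { split; [apply pow_lt; lra|]. apply pow_lt_1_compat; [lra|]. apply INR_lt. simpl. lra. }
  assert (Hi : 0 < lam ^ i <= 1).
  { split; [apply pow_lt; lra|]. replace 1 with (lam ^ 0) by reflexivity. apply pow_antitone; lra || lia. }
  pose proof (cantor_sum_range (lam ^ d) (fun k => b (i + k * d)%nat) Hrho) as [H0 H1].
  unfold cantor_coord. set (z := cantor_sum _ _) in *. set (rho := lam ^ d) in *.
  assert (Hdp : 0 < / (2 * INR d)) by (apply Rinv_0_lt_compat; lra).
  replace ((1 - rho) / (2 * INR d) * lam ^ i * z) with (/ (2 * INR d) * (lam ^ i * ((1 - rho) * z)))
    by (field; lra).
  assert (0 <= (1 - rho) * z <= 1).
  { split; [apply Rmult_le_pos; lra|]. apply Rmult_le_compat_l with (r := 1 - rho) in H1; [|lra].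
    rewrite Rinv_r in H1 by lra. exact H1. }
  split; [apply Rmult_le_pos; [lra|apply Rmult_le_pos; lra]|].
  rewrite <- (Rmult_1_r (/ (2 * INR d))) at 2. apply Rmult_le_compat_l; [lra|]. nra.
Qed.

Lemma normsq_cantor_coord (d : nat) (lam : R) (b : stream) :
  (1 <= d)%nat -> 0 < lam < 1 -> normsq d (cantor_coord d lam b) <= 1 / 4.
Proof.
  intros Hd Hl.
  assert (HD : 1 <= INR d) by (apply (le_INR 1); easy).
  assert (HDi : INR d * / INR d = 1) by (apply Rinv_r; lra).
  assert (Hi : 0 < / INR d <= 1) by (split; [apply Rinv_0_lt_compat; lra|rewrite <- Rinv_1; apply Rinv_le_contravar; lra]).
  apply Rle_trans with (sumR d (fun _ => / (2 * INR d) * / (2 * INR d))).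
  - apply sumR_le. intros i _. pose proof (cantor_coord_range d lam b i Hd Hl).
    apply Rmult_le_compat; lra.
  - rewrite sumR_const, Rinv_mult. nra.
Qed.

(** Writing m = i + k d with i < d, bit m is the k-th bit of coordinate i and has weight lam^i
    (lam^d)^k = lam^m. Coordinate i alone gives the lower bound; for the upper bound all coordinates
    are summed. *)
Lemma cantor_pt_param (d : nat) (lam : R) :
  (1 <= d)%nat -> 0 < lam < 1 -> lam ^ d < 1 / 2 ->
  exists c C, 0 < c /\ 0 < C /\ cantor_param (S d) lam c C (cantor_pt d lam).
Proof.
  intros Hd Hl Hhalf.
  assert (HD : 1 <= INR d) by (apply (le_INR 1); easy).
  assert (Hrho : 0 < lam ^ d) by (apply pow_lt; lra).
  set (rho := lam ^ d) in *.
  set (a := (1 - rho) / (2 * INR d)).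
  assert (Ha : 0 < a) by (apply Rdiv_lt_0_compat; lra).
  set (e := (1 - 2 * rho) / (1 - rho)).
  assert (He : 0 < e) by (apply Rdiv_lt_0_compat; lra).
  (* The division by rho pays for rounding m/d down: rho^(m/d) <= lam^m / rho. *)
  set (D := a * / (1 - rho) / rho).
  assert (HDp : 0 < D) by (repeat apply Rdiv_lt_0_compat || apply Rmult_lt_0_compat; try apply Rinv_0_lt_compat; lra).
  assert (Hcoord : forall b i, (i < d)%nat -> cantor_pt d lam b i = cantor_coord d lam b i).
  { intros b i Hi. unfold cantor_pt. destruct lt_dec; [reflexivity|lia]. }
  assert (Hlast : forall b, cantor_pt d lam b d = sqrt (1 - normsq d (cantor_coord d lam b))).
  { intros b. unfold cantor_pt. destruct lt_dec; [lia|]. destruct Nat.eq_dec; [reflexivity|lia]. }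
  assert (Hup : forall m b b' i, agree m b b' -> (i < d)%nat ->
    Rabs (cantor_coord d lam b i - cantor_coord d lam b' i) <= D * lam ^ m).
  { intros m b b' i Hag Hi. unfold cantor_coord. fold rho. fold a.
    rewrite <- Rmult_minus_distr_l, Rabs_mult, Rabs_pos_eq
      by (apply Rmult_le_pos; [lra|apply pow_le; lra]).
    set (k := (m / d)%nat).
    pose proof (Nat.div_mod_eq m d). pose proof (Nat.mod_upper_bound m d ltac:(lia)).
    assert (Hsub : agree k (fun k => b (i + k * d)%nat) (fun k => b' (i + k * d)%nat)).
    { intros j Hj. apply Hag. fold k in H.
      assert ((j + 1) * d <= k * d)%nat by (apply Nat.mul_le_mono_r; lia). lia. }
    apply (cantor_sum_upper rho) in Hsub; [|lra].
    assert (Hi1 : 0 < lam ^ i <= 1).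
    { split; [apply pow_lt; lra|]. replace 1 with (lam ^ 0) by reflexivity. apply pow_antitone; lra || lia. }
    assert (Hk : rho ^ k <= lam ^ m / rho).
    { apply Rmult_le_reg_r with rho; [easy|]. replace (lam ^ m / rho * rho) with (lam ^ m) by (field; lra).
      unfold rho. rewrite <- pow_mult, <- pow_add. apply pow_antitone; [lra|]. fold k in H. lia. }
    replace (D * lam ^ m) with (a * (lam ^ m / rho / (1 - rho))) by (unfold D; field; lra).
    rewrite Rmult_assoc. apply Rmult_le_compat_l; [lra|].
    pose proof (Rabs_pos (cantor_sum rho (fun k => b (i + k * d)%nat) - cantor_sum rho (fun k => b' (i + k * d)%nat))).
    apply Rle_trans with (1 * (rho ^ k / (1 - rho))).
    - apply Rmult_le_compat; lra.
    - rewrite Rmult_1_l. apply Rmult_le_compat_r; [left; apply Rinv_0_lt_compat; lra|easy]. }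
  (* The d free coordinates contribute d D lam^m, and the last one D lam^m, at most as much
     again. *)
  exists (a * e), (2 * INR d * D). split; [now apply Rmult_lt_0_compat|].
  split; [apply Rmult_lt_0_compat; lra|]. split; [|split].
  - intros b. split.
    + intros i Hi. unfold cantor_pt. destruct lt_dec; [lia|]. destruct Nat.eq_dec; [lia|reflexivity].
    + unfold normsq. simpl. rewrite Hlast, sqrt_sqrt.
      * rewrite (sumR_ext d _ (fun i => cantor_coord d lam b i * cantor_coord d lam b i))
          by (intros; now rewrite Hcoord). unfold normsq. ring.
      * pose proof (normsq_cantor_coord d lam b Hd Hl). lra.
  - intros m b b' Hag.
    apply Rle_trans with (1 := dist_le_sum _ _ _). simpl.
    assert (Hlm : 0 < lam ^ m) by (apply pow_lt; lra).
    assert (H1 : sumR d (fun i => Rabs (cantor_pt d lam b i - cantor_pt d lam b' i)) <= INR d * (D * lam ^ m)).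
    { rewrite <- sumR_const. apply sumR_le. intros i Hi. rewrite !Hcoord by easy. now apply Hup. }
    assert (H2 : Rabs (cantor_pt d lam b d - cantor_pt d lam b' d) <= D * lam ^ m).
    { rewrite !Hlast.
      pose proof (normsq_cantor_coord d lam b Hd Hl). pose proof (normsq_cantor_coord d lam b' Hd Hl).
      eapply Rle_trans; [apply sqrt_lipschitz; lra|].
      (* A difference of squares in each coordinate: the sums of two coordinates are at most 1/d,
         which offsets the number d of terms. *)
      replace (1 - _ - _) with (sumR d (fun i => (cantor_coord d lam b' i + cantor_coord d lam b i)
        * (cantor_coord d lam b' i - cantor_coord d lam b i))).
      2:{ transitivity (normsq d (cantor_coord d lam b') + -1 * normsq d (cantor_coord d lam b)); [|ring].
          unfold normsq. rewrite <- sumR_scal, <- sumR_plus. apply sumR_ext. intros; ring. }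
      assert (Hterm : forall i, (i < d)%nat -> Rabs ((cantor_coord d lam b' i + cantor_coord d lam b i)
        * (cantor_coord d lam b' i - cantor_coord d lam b i)) <= / INR d * (D * lam ^ m)).
      { intros i Hi. rewrite Rabs_mult, (Rabs_minus_sym (cantor_coord d lam b' i)).
        pose proof (cantor_coord_range d lam b i Hd Hl). pose proof (cantor_coord_range d lam b' i Hd Hl).
        rewrite Rabs_pos_eq by lra.
        replace (/ INR d) with (/ (2 * INR d) + / (2 * INR d)) by (field; lra).
        apply Rmult_le_compat; [lra|apply Rabs_pos|lra|now apply Hup]. }
      replace (D * lam ^ m) with (INR d * (/ INR d * (D * lam ^ m))) by (field; lra).
      rewrite <- sumR_const. apply Rabs_le. split.
      - apply Ropp_le_cancel. rewrite Ropp_involutive.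
        replace (- sumR d _) with (-1 * sumR d (fun i => (cantor_coord d lam b' i + cantor_coord d lam b i)
          * (cantor_coord d lam b' i - cantor_coord d lam b i))) by ring.
        rewrite <- sumR_scal. apply sumR_le. intros i Hi.
        specialize (Hterm i Hi). apply Rabs_le_between in Hterm. lra.
      - apply sumR_le. intros i Hi. specialize (Hterm i Hi). apply Rabs_le_between in Hterm. lra. }
    assert (0 < D * lam ^ m) by now apply Rmult_lt_0_compat. nra.
  - intros m b b' Hag Hne.
    pose proof (Nat.div_mod_eq m d) as Hm. pose proof (Nat.mod_upper_bound m d ltac:(lia)) as Hi.
    set (i := (m mod d)%nat) in *. set (k := (m / d)%nat) in *.
    apply Rle_trans with (2 := coord_le_dist (S d) i _ _ ltac:(lia)).
    rewrite !Hcoord by easy. unfold cantor_coord. fold rho. fold a.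
    rewrite <- Rmult_minus_distr_l, Rabs_mult, Rabs_pos_eq
      by (apply Rmult_le_pos; [lra|apply pow_le; lra]).
    assert (Hk := cantor_sum_lower rho k (fun k => b (i + k * d)%nat) (fun k => b' (i + k * d)%nat)
      ltac:(lra) ltac:(intros j Hj; apply Hag;
        assert ((j + 1) * d <= k * d)%nat by (apply Nat.mul_le_mono_r; lia); lia)
      ltac:(cbv beta; replace (i + k * d)%nat with m by lia; exact Hne)).
    fold e in Hk.
    replace (a * e * lam ^ m) with (a * lam ^ i * (rho ^ k * e)).
    + apply Rmult_le_compat_l; [|exact Hk]. apply Rmult_le_pos; [lra|apply pow_le; lra].
    + rewrite Hm, pow_add, pow_mult. fold rho. ring.
Qed.

Lemma exists_cantor_param (n : nat) (s : R) : (2 <= n)%nat -> 0 < s -> s < INR n - 1 ->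
  exists lam c C xi, 0 < lam < 1 /\ Rpower lam s = 1 / 2 /\ 0 < c /\ 0 < C /\
    cantor_param n lam c C xi.
Proof.
  intros Hn Hs Hsn. destruct n as [|d]; [lia|]. rewrite S_INR in Hsn.
  assert (Hln : 0 < ln 2) by (rewrite <- ln_1; apply ln_increasing; lra).
  (* This is 2^(-1/s), the solution of lam^s = 1/2; then s < d gives lam^d < 1/2. *)
  set (lam := exp (- (ln 2 / s))).
  assert (0 < ln 2 / s) by now apply Rdiv_lt_0_compat.
  assert (Hl : 0 < lam < 1).
  { split; [apply exp_pos|]. rewrite <- exp_0. apply exp_increasing. lra. }
  assert (Hhalf : exp (- ln 2) = 1 / 2) by (rewrite exp_Ropp, exp_ln; lra).
  assert (Hd : lam ^ d < 1 / 2).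
  { rewrite <- Rpower_pow by easy. unfold Rpower, lam. rewrite ln_exp, <- Hhalf.
    apply exp_increasing.
    replace (- ln 2) with (- (s * (ln 2 / s))) by (field; lra).
    assert (s * (ln 2 / s) < INR d * (ln 2 / s)) by (apply Rmult_lt_compat_r; lra). lra. }
  destruct (cantor_pt_param d lam ltac:(lia) Hl Hd) as (c & C & Hc & HC & Hp).
  exists lam, c, C, (cantor_pt d lam). repeat split; try easy; try apply Hp.
  unfold Rpower, lam. rewrite ln_exp, <- Hhalf. f_equal. field. lra.
Qed.

(** * Integrals depending on a parameter *)

(** Joint continuity at (x, b), with the product topology on streams; it is the hypothesis for
    exchanging the mean with limits and derivatives in x. *)
Definition jcont (n : nat) (f : pt -> stream -> R) (x : pt) (b : stream) : Prop :=
  forall eps, 0 < eps -> exists delta, 0 < delta /\ exists m, forall y b',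
    dist n x y < delta -> agree m b b' -> Rabs (f y b' - f x b) < eps.

Lemma jcont_const (n : nat) (c : R) (x : pt) (b : stream) : jcont n (fun _ _ => c) x b.
Proof.
  intros eps He. exists 1. split; [lra|]. exists O. intros. now rewrite Rminus_diag, Rabs_R0.
Qed.

Lemma jcont_coord (n i : nat) (x : pt) (b : stream) : (i < n)%nat -> jcont n (fun y _ => y i) x b.
Proof.
  intros Hi eps He. exists eps. split; [easy|]. exists O. intros y b' Hy _.
  rewrite Rabs_minus_sym. now apply Rle_lt_trans with (1 := coord_le_dist n i x y Hi).
Qed.

Lemma jcont_comp (n : nat) (g : R -> R) (f : pt -> stream -> R) (x : pt) (b : stream) :
  continuity_pt g (f x b) -> jcont n f x b -> jcont n (fun y b => g (f y b)) x b.
Proof.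
  intros Hg Hf eps He. destruct (Hg eps He) as [al [Hal H]].
  destruct (Hf al Hal) as [delta [Hd [m Hm]]].
  exists delta. split; [easy|]. exists m. intros y b' Hy Hb.
  destruct (Req_dec (f y b') (f x b)) as [->|Hne]; [now rewrite Rminus_diag, Rabs_R0|].
  apply H. split; [split; [exact Logic.I|auto]|]. now apply Hm.
Qed.

Lemma jcont_plus (n : nat) (f g : pt -> stream -> R) (x : pt) (b : stream) :
  jcont n f x b -> jcont n g x b -> jcont n (fun y b => f y b + g y b) x b.
Proof.
  intros Hf Hg eps He.
  destruct (Hf (eps / 2)) as [d1 [Hd1 [m1 H1]]]; [lra|].
  destruct (Hg (eps / 2)) as [d2 [Hd2 [m2 H2]]]; [lra|].
  exists (Rmin d1 d2). split; [now apply Rmin_glb_lt|]. exists (max m1 m2). intros y b' Hy Hb.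
  specialize (H1 y b' (Rlt_le_trans _ _ _ Hy (Rmin_l _ _)) (agree_le _ _ _ _ (Nat.le_max_l _ _) Hb)).
  specialize (H2 y b' (Rlt_le_trans _ _ _ Hy (Rmin_r _ _)) (agree_le _ _ _ _ (Nat.le_max_r _ _) Hb)).
  apply Rabs_lt_between in H1. apply Rabs_lt_between in H2. apply Rabs_def1; lra.
Qed.

Lemma continuity_pt_square (z : R) : continuity_pt (fun z => z * z) z.
Proof. apply derivable_continuous_pt. reg. Qed.

(* Multiplication is obtained from squares by polarization. *)
Lemma jcont_mult (n : nat) (f g : pt -> stream -> R) (x : pt) (b : stream) :
  jcont n f x b -> jcont n g x b -> jcont n (fun y b => f y b * g y b) x b.
Proof.
  intros Hf Hg.
  assert (Hsc : forall c u, jcont n u x b -> jcont n (fun y b => c * u y b) x b).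
  { intros c u Hu. apply (jcont_comp n (fun z => c * z)); [|easy].
    apply derivable_continuous_pt. reg. }
  assert (H1 : jcont n (fun y b => (f y b + g y b) * (f y b + g y b)) x b).
  { apply (jcont_comp n (fun z => z * z) (fun y b => f y b + g y b)); [apply continuity_pt_square|].
    now apply jcont_plus. }
  assert (H2 : jcont n (fun y b => (f y b + -1 * g y b) * (f y b + -1 * g y b)) x b).
  { apply (jcont_comp n (fun z => z * z) (fun y b => f y b + -1 * g y b));
      [apply continuity_pt_square|].
    apply jcont_plus; [easy|now apply Hsc]. }
  apply (Hsc (/ 4)) in H1. apply (Hsc (- / 4)) in H2.
  intros eps He. destruct (jcont_plus _ _ _ _ _ H1 H2 eps He) as [delta [Hd [m H]]].
  exists delta. split; [easy|]. exists m. intros y b' Hy Hb. specialize (H y b' Hy Hb).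
  cbv beta in H. replace (f y b' * g y b' - f x b * g x b) with
    (/ 4 * ((f y b' + g y b') * (f y b' + g y b')) + - / 4 * ((f y b' + -1 * g y b') * (f y b' + -1 * g y b'))
     - (/ 4 * ((f x b + g x b) * (f x b + g x b)) + - / 4 * ((f x b + -1 * g x b) * (f x b + -1 * g x b))))
    by field. exact H.
Qed.

Lemma jcont_opp (n : nat) (f : pt -> stream -> R) (x : pt) (b : stream) :
  jcont n f x b -> jcont n (fun y b => - f y b) x b.
Proof. apply (jcont_comp n Ropp). apply derivable_continuous_pt. reg. Qed.

Lemma jcont_inv (n : nat) (f : pt -> stream -> R) (x : pt) (b : stream) :
  f x b <> 0 -> jcont n f x b -> jcont n (fun y b => / f y b) x b.
Proof.
  intros H. apply (jcont_comp n Rinv). apply continuity_pt_filterlim.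
  apply (continuous_Rinv (f x b) H).
Qed.

Lemma jcont_exp (n : nat) (f : pt -> stream -> R) (x : pt) (b : stream) :
  jcont n f x b -> jcont n (fun y b => exp (f y b)) x b.
Proof. apply (jcont_comp n exp). apply derivable_continuous_pt, derivable_pt_exp. Qed.

Lemma jcont_ln (n : nat) (f : pt -> stream -> R) (x : pt) (b : stream) :
  0 < f x b -> jcont n f x b -> jcont n (fun y b => ln (f y b)) x b.
Proof.
  intros H. apply (jcont_comp n ln). apply derivable_continuous_pt.
  exists (/ f x b). now apply derivable_pt_lim_ln.
Qed.

Lemma jcont_sumR (n N : nat) (f : nat -> pt -> stream -> R) (x : pt) (b : stream) :
  (forall i, (i < N)%nat -> jcont n (f i) x b) ->
  jcont n (fun y b => sumR N (fun i => f i y b)) x b.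
Proof.
  induction N as [|N IH]; intros H; simpl; [apply jcont_const|].
  apply jcont_plus; [apply IH; intros; apply H; lia|apply H; lia].
Qed.

(** Compactness of the stream space. Call a prefix bad if no delta and m serve all streams through
    it. If both extensions are good, so is the prefix, with the smaller delta and the larger m; a
    bad root would thus start a bad branch g, contradicting joint continuity at (x, g). *)
Lemma jcont_uniform (n : nat) (f : pt -> stream -> R) (x : pt) :
  (forall b, jcont n f x b) -> forall eps, 0 < eps -> exists delta, 0 < delta /\ exists m,
    forall y b b', dist n x y < delta -> agree m b b' -> Rabs (f y b' - f x b) < eps.
Proof.
  intros Hf eps He.
  set (P := fun p g => ~ exists delta, 0 < delta /\ exists m, forall y b b',
    agree p g b -> dist n x y < delta -> agree m b b' -> Rabs (f y b' - f x b) < eps).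
  apply NNPP. intros Hno.
  destruct (branch_exists P (fun _ => false)) as [g Hg].
  - intros [delta [Hd [m H]]]. apply Hno. exists delta. split; [easy|]. exists m.
    intros y b b'. apply H. intros j; lia.
  - intros p g Hp. apply NNPP. intros Hs.
    assert (HQ : forall h, exists delta, 0 < delta /\ exists m, forall y b b',
      agree (S p) (upd g p h) b -> dist n x y < delta -> agree m b b' ->
      Rabs (f y b' - f x b) < eps).
    { intros h. apply NNPP. intros H. apply Hs. now exists h. }
    destruct (HQ false) as [d0 [Hd0 [m0 H0]]], (HQ true) as [d1 [Hd1 [m1 H1]]].
    apply Hp. exists (Rmin d0 d1). split; [now apply Rmin_glb_lt|]. exists (max m0 m1).
    intros y b b' Hb Hy Hbb.
    pose proof (agree_S_upd p g b Hb) as Hc.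
    destruct (b p); [apply H1|apply H0]; try exact Hc.
    + exact (Rlt_le_trans _ _ _ Hy (Rmin_r _ _)).
    + exact (agree_le _ _ _ _ (Nat.le_max_r _ _) Hbb).
    + exact (Rlt_le_trans _ _ _ Hy (Rmin_l _ _)).
    + exact (agree_le _ _ _ _ (Nat.le_max_l _ _) Hbb).
  - intros p g g' Hgg Hp [delta [Hd [m H]]]. apply Hp. exists delta. split; [easy|].
    exists m. intros y b b' Hb. apply H. apply agree_trans with g; [now apply agree_sym|easy].
  - destruct (Hf g (eps / 2)) as [delta [Hd [m H]]]; [lra|].
    apply (Hg m). exists delta. split; [easy|]. exists m. intros y b b' Hb Hy Hbb.
    pose proof (H y b' Hy (agree_trans _ _ _ _ Hb Hbb)) as H1.
    pose proof (H x b ltac:(rewrite dist_refl; easy) Hb) as H2.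
    apply Rabs_lt_between in H1. apply Rabs_lt_between in H2. apply Rabs_def1; lra.
Qed.

Lemma jcont_ucont (n : nat) (f : pt -> stream -> R) (x : pt) :
  (forall b, jcont n f x b) -> ucont (f x).
Proof.
  intros Hf eps He. destruct (jcont_uniform n f x Hf eps He) as [delta [Hd [m H]]].
  exists m. intros b b' Hb. apply H; [now rewrite dist_refl|now apply agree_sym].
Qed.

Lemma continuous_on_mean (n : nat) (f : pt -> stream -> R) :
  (forall x, Ball n x -> forall b, jcont n f x b) -> continuous_on n (Ball n) (fun x => mean (f x)).
Proof.
  intros Hf x Hx eps He.
  destruct (jcont_uniform n f x (Hf x Hx) (eps / 2)) as [delta [Hd [m H]]]; [lra|].
  exists delta. split; [easy|]. intros y Hy Hxy.
  replace (mean (f y) - mean (f x)) with (1 * mean (f y) + -1 * mean (f x)) by ring.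
  rewrite <- mean_lin by now apply (jcont_ucont n), Hf.
  apply Rle_lt_trans with (eps / 2); [|lra].
  apply mean_abs_le; [apply ucont_lin; now apply (jcont_ucont n), Hf|].
  intros b. left. replace (1 * f y b + -1 * f x b) with (f y b - f x b) by ring.
  apply H; [easy|]. now intros j _.
Qed.

Lemma has_partial_at (f : pt -> R) (i : nat) (x : pt) (t l : R) :
  has_partial f i (shift x i t) l -> is_derive (fun t => f (shift x i t)) t l.
Proof.
  intros H. apply is_derive_Reals. intros eps He. destruct (H eps He) as [delta Hd].
  exists delta. intros z Hz Hzd. specialize (Hd z Hz Hzd).
  now rewrite !shift_shift, Rplus_0_l, Rplus_0_r in Hd.
Qed.

(** Differentiation under the integral: for each b the mean value theorem turns the difference
    quotient into a value of [f1] at a nearby point, and [jcont_uniform] makes its distance from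
    [f1 x b] small uniformly in b. *)
Lemma has_partial_mean (n i : nat) (f f1 : pt -> stream -> R) (x : pt) :
  (i < n)%nat -> Ball n x ->
  (forall y, Ball n y -> forall b, has_partial (fun y => f y b) i y (f1 y b)) ->
  (forall y, Ball n y -> ucont (f y)) -> (forall b, jcont n f1 x b) ->
  has_partial (fun y => mean (f y)) i x (mean (f1 x)).
Proof.
  intros Hi Hx Hp Hu Hj eps He.
  destruct (jcont_uniform n f1 x Hj (eps / 2)) as [delta [Hd [m H]]]; [lra|].
  destruct (Ball_open n x Hx) as [r [Hr Hball]].
  assert (HB : forall t, Rabs t < r -> Ball n (shift x i t)).
  { intros t Ht. apply Hball; [apply InR_shift; [easy|apply Hx]|now rewrite dist_shift]. }
  exists (mkposreal (Rmin delta r) (Rmin_glb_lt _ _ _ Hd Hr)). simpl. intros t Ht0 Ht.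
  assert (Ht1 : Rabs t < delta) by exact (Rlt_le_trans _ _ _ Ht (Rmin_l _ _)).
  assert (Ht2 : Rabs t < r) by exact (Rlt_le_trans _ _ _ Ht (Rmin_r _ _)).
  rewrite Rplus_0_l, shift_0.
  replace (_ - _) with (1 * (/ t * mean (f (shift x i t)) + - / t * mean (f x)) + -1 * mean (f1 x))
    by (field; easy).
  assert (U1 : ucont (f (shift x i t))) by now apply Hu, HB.
  assert (U2 : ucont (f x)) by now apply Hu.
  assert (U3 : ucont (f1 x)) by now apply (jcont_ucont n).
  rewrite <- mean_lin, <- mean_lin by (try apply ucont_lin; easy).
  apply Rle_lt_trans with (eps / 2); [|lra].
  apply mean_abs_le; [now repeat apply ucont_lin|]. intros b.
  destruct (MVT_gen (fun t => f (shift x i t) b) 0 t (fun t => f1 (shift x i t) b)) as [c [Hc Heq]].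
  - intros z Hz. apply (has_partial_at (fun y => f y b)). apply Hp, HB.
    apply Rle_lt_trans with (2 := Ht2). unfold Rmin, Rmax in Hz.
    destruct (Rle_dec 0 t); [rewrite !Rabs_pos_eq; lra|rewrite !Rabs_left1; lra].
  - intros z Hz. apply derivable_continuous_pt. exists (f1 (shift x i z) b).
    apply is_derive_Reals. apply (has_partial_at (fun y => f y b)). apply Hp, HB.
    apply Rle_lt_trans with (2 := Ht2). unfold Rmin, Rmax in Hz.
    destruct (Rle_dec 0 t); [rewrite !Rabs_pos_eq; lra|rewrite !Rabs_left1; lra].
  - rewrite shift_0, Rminus_0_r in Heq.
    replace (_ + _) with (f1 (shift x i c) b - f1 x b).
    + left. apply H; [|now intros j _]. rewrite dist_shift by easy.
      apply Rle_lt_trans with (2 := Ht1). unfold Rmin, Rmax in Hc.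
      destruct (Rle_dec 0 t); [rewrite !Rabs_pos_eq; lra|rewrite !Rabs_left1; lra].
    + replace (1 * _) with (/ t * (f (shift x i t) b - f x b)) by ring. rewrite Heq. field. easy.
Qed.

(** * The lambda_1-harmonic kernel *)

(* With P = (1 - |x|^2) / |x - xi|^2 the Poisson kernel, log_kernel is ln P, and the kernel
   P^h (ln P + kap) is ker0; ker1 and ker2 are its first and second partial derivatives in x. *)
Definition log_kernel (n : nat) (xi x : pt) : R :=
  ln (1 - normsq n x) - ln (normsq n (fun k => x k - xi k)).

Definition ker0 (n : nat) (h kap : R) (xi x : pt) : R :=
  exp (h * log_kernel n xi x) * (log_kernel n xi x + kap).

Definition dlog (n : nat) (xi : pt) (i : nat) (x : pt) : R :=
  - (2 * x i) * / (1 - normsq n x) - 2 * (x i - xi i) * / normsq n (fun k => x k - xi k).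

Definition kron (i j : nat) : R := if Nat.eqb i j then 1 else 0.

Definition ddlog (n : nat) (xi : pt) (i j : nat) (x : pt) : R :=
  - (2 * kron i j) * / (1 - normsq n x)
  - 4 * x i * x j * (/ (1 - normsq n x) * / (1 - normsq n x))
  - 2 * kron i j * / normsq n (fun k => x k - xi k)
  + 4 * (x i - xi i) * (x j - xi j)
    * (/ normsq n (fun k => x k - xi k) * / normsq n (fun k => x k - xi k)).

Definition ker1 (n : nat) (h kap : R) (xi : pt) (i : nat) (x : pt) : R :=
  exp (h * log_kernel n xi x) * (h * log_kernel n xi x + (h * kap + 1)) * dlog n xi i x.

Definition ker2 (n : nat) (h kap : R) (xi : pt) (i j : nat) (x : pt) : R :=
  exp (h * log_kernel n xi x) * (h * h * log_kernel n xi x + (h * h * kap + 2 * h))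
    * (dlog n xi i x * dlog n xi j x)
  + exp (h * log_kernel n xi x) * (h * log_kernel n xi x + (h * kap + 1)) * ddlog n xi i j x.

Lemma dist2_pos (n : nat) (x xi : pt) :
  Ball n x -> Sphere n xi -> 0 < normsq n (fun k => x k - xi k).
Proof.
  intros [_ Hx] Hxi. pose proof (dist_Sphere_ge n x xi ltac:(lra) Hxi) as H.
  rewrite <- dist_sqr. nra.
Qed.

Lemma normsq_shift0 (n i : nat) (x : pt) (t : R) : (i < n)%nat ->
  normsq n (shift x i t) = normsq n x + 2 * x i * t + t * t.
Proof.
  intros Hi. pose proof (normsq_shift n i x (fun _ => 0) t Hi) as H. cbv beta in H.
  assert (E : forall y, normsq n (fun k => y k - 0) = normsq n y)
    by (intros y; apply sumR_ext; intros; ring).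
  rewrite !E in H. rewrite H. ring.
Qed.

Lemma shift_coord (x : pt) (i j : nat) (t : R) : shift x j t i = x i + kron i j * t.
Proof. unfold shift, kron. destruct (Nat.eqb i j); ring. Qed.

(** Along the i-th coordinate line |x|^2 and |x - xi|^2 are quadratic in t; here q = 1 - |x|^2, r =
    |x - xi|^2, p = x_i and z = x_i - xi_i. *)
Lemma derive_ker0_aux (h kap q r p z : R) : 0 < q -> 0 < r ->
  is_derive (fun t => exp (h * (ln (1 - (1 - q + 2 * p * t + t * t)) - ln (r + 2 * z * t + t * t)))
    * (ln (1 - (1 - q + 2 * p * t + t * t)) - ln (r + 2 * z * t + t * t) + kap)) 0
    (exp (h * (ln q - ln r)) * (h * (ln q - ln r) + (h * kap + 1)) * (- (2 * p) * / q - 2 * z * / r)).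
Proof.
  intros Hq Hr. auto_derive.
  - repeat split; lra.
  - unfold Rminus. replace (1 + - (1 + - q + 2 * p * 0 + 0 * 0)) with q by ring.
    replace (r + 2 * z * 0 + 0 * 0) with r by ring. field. lra.
Qed.

(** Now the line is in direction j, with p = x_j and z = x_j - xi_j, whereas p' = x_i, z' = xi_i and
    d is the Kronecker symbol. *)
Lemma derive_ker1_aux (h kap q r p z p' z' d : R) : 0 < q -> 0 < r ->
  is_derive (fun t => exp (h * (ln (1 - (1 - q + 2 * p * t + t * t)) - ln (r + 2 * z * t + t * t)))
    * (h * (ln (1 - (1 - q + 2 * p * t + t * t)) - ln (r + 2 * z * t + t * t)) + (h * kap + 1))
    * (- (2 * (p' + d * t)) * / (1 - (1 - q + 2 * p * t + t * t))
       - 2 * (p' + d * t - z') * / (r + 2 * z * t + t * t))) 0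
    (exp (h * (ln q - ln r)) * (h * h * (ln q - ln r) + (h * h * kap + 2 * h))
      * ((- (2 * p') * / q - 2 * (p' - z') * / r) * (- (2 * p) * / q - 2 * z * / r))
     + exp (h * (ln q - ln r)) * (h * (ln q - ln r) + (h * kap + 1))
      * (- (2 * d) * / q - 4 * p' * p * (/ q * / q) - 2 * d * / r + 4 * (p' - z') * z * (/ r * / r))).
Proof.
  intros Hq Hr. auto_derive.
  - repeat split; lra.
  - unfold Rminus. replace (1 + - (1 + - q + 2 * p * 0 + 0 * 0)) with q by ring.
    replace (r + 2 * z * 0 + 0 * 0) with r by ring. field. lra.
Qed.

Lemma has_partial_ker0 (n : nat) (h kap : R) (xi : pt) (i : nat) (x : pt) :
  (i < n)%nat -> Ball n x -> Sphere n xi ->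
  has_partial (ker0 n h kap xi) i x (ker1 n h kap xi i x).
Proof.
  intros Hi Hx Hxi. unfold has_partial. apply is_derive_Reals.
  eapply is_derive_ext; [|apply derive_ker0_aux; [|exact (dist2_pos n x xi Hx Hxi)]].
  - intros t. unfold ker0, log_kernel. rewrite normsq_shift0, normsq_shift by easy.
    replace (1 - (1 - normsq n x)) with (normsq n x) by ring. reflexivity.
  - destruct Hx; lra.
Qed.

Lemma has_partial_ker1 (n : nat) (h kap : R) (xi : pt) (i j : nat) (x : pt) :
  (j < n)%nat -> Ball n x -> Sphere n xi ->
  has_partial (ker1 n h kap xi i) j x (ker2 n h kap xi i j x).
Proof.
  intros Hj Hx Hxi. unfold has_partial. apply is_derive_Reals.
  eapply is_derive_ext; [|apply derive_ker1_aux; [|exact (dist2_pos n x xi Hx Hxi)]].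
  - intros t. unfold ker1, dlog, log_kernel.
    rewrite normsq_shift0, normsq_shift, shift_coord by easy.
    replace (1 - (1 - normsq n x)) with (normsq n x) by ring. reflexivity.
  - destruct Hx; lra.
Qed.

(** ln P is minus a Busemann function: its gradient has hyperbolic norm 1 and its Laplacian is the
    constant -(n-1). *)
Lemma log_kernel_laplacian (n : nat) (xi x : pt) : Ball n x -> Sphere n xi ->
  let q := 1 - normsq n x in
  sumR n (fun i => dlog n xi i x * dlog n xi i x) = 4 / (q * q) /\
  q * q / 4 * sumR n (fun i => ddlog n xi i i x)
  + (INR n - 2) * (q / 2) * sumR n (fun i => x i * dlog n xi i x) = - (INR n - 1).
Proof.
  intros Hx Hxi q. pose proof (dist2_pos n x xi Hx Hxi) as Hr.
  set (r := normsq n (fun k => x k - xi k)) in *.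
  assert (Hq : 0 < q) by (destruct Hx; unfold q; lra).
  assert (Hxx : normsq n x = 1 - q) by (unfold q; ring).
  (* since |xi| = 1 *)
  assert (Hdot : sumR n (fun i => x i * (x i - xi i)) = (r - q) / 2).
  { assert (E : normsq n xi = normsq n x + -2 * sumR n (fun i => x i * (x i - xi i)) + r).
    { unfold r, normsq. rewrite <- sumR_scal, <- !sumR_plus. apply sumR_ext; intros; ring. }
    destruct Hxi as [_ Hxi]. lra. }
  split.
  - rewrite (sumR_ext n _ (fun i => 4 / (q * q) * (x i * x i) + (8 / (q * r) * (x i * (x i - xi i))
      + 4 / (r * r) * ((x i - xi i) * (x i - xi i))))).
    + rewrite !sumR_plus, !sumR_scal, Hdot. fold (normsq n x). fold (normsq n (fun k => x k - xi k)).
      fold r. rewrite Hxx. field. lra.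
    + intros i _. unfold dlog. fold q. fold r. field. lra.
  - rewrite (sumR_ext n (fun i => ddlog n xi i i x) (fun i => (-2 / q - 2 / r)
      + ((-4 / (q * q)) * (x i * x i) + 4 / (r * r) * ((x i - xi i) * (x i - xi i))))).
    2:{ intros i _. unfold ddlog, kron. rewrite Nat.eqb_refl. fold q. fold r. field. lra. }
    rewrite (sumR_ext n (fun i => x i * dlog n xi i x) (fun i => (-2 / q) * (x i * x i)
      + (-2 / r) * (x i * (x i - xi i)))).
    2:{ intros i _. unfold dlog. fold q. fold r. field. lra. }
    rewrite !sumR_plus, !sumR_scal, sumR_const, Hdot. fold (normsq n x).
    fold (normsq n (fun k => x k - xi k)). fold r. rewrite Hxx. field. lra.
Qed.

(** For G(L) = e^(hL) (L + kap) and L = ln P the chain rule gives Delta G(L) = G'' - 2h G', and G''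
    - 2h G' + h^2 G = 0 because h is a double characteristic root. [g1] and [g2] are G' and G''. *)
Lemma ker_laplacian (n : nat) (kap : R) (xi x : pt) : Ball n x -> Sphere n xi ->
  let h := (INR n - 1) / 2 in
  hyp_laplacian n (ker1 n h kap xi) (ker2 n h kap xi) x = - (h * h) * ker0 n h kap xi x.
Proof.
  intros Hx Hxi h. destruct (log_kernel_laplacian n xi x Hx Hxi) as [H1 H2].
  unfold hyp_laplacian. cbv zeta in *. set (q := 1 - normsq n x) in *.
  assert (Hq : 0 < q) by (destruct Hx; unfold q; lra).
  unfold ker0. set (L := log_kernel n xi x).
  set (g1 := exp (h * L) * (h * L + (h * kap + 1))).
  set (g2 := exp (h * L) * (h * h * L + (h * h * kap + 2 * h))).
  rewrite (sumR_ext n (fun i => ker2 n h kap xi i i x)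
    (fun i => g2 * (dlog n xi i x * dlog n xi i x) + g1 * ddlog n xi i i x)) by reflexivity.
  rewrite (sumR_ext n (fun i => x i * ker1 n h kap xi i x) (fun i => g1 * (x i * dlog n xi i x)))
    by (intros; unfold ker1, g1, L; ring).
  rewrite sumR_plus, !sumR_scal, H1.
  transitivity (g2 + g1 * (q * q / 4 * sumR n (fun i => ddlog n xi i i x)
    + (INR n - 2) * (q / 2) * sumR n (fun i => x i * dlog n xi i x))); [field; lra|].
  rewrite H2. replace (INR n - 1) with (2 * h) by (unfold h; field). unfold g1, g2. ring.
Qed.

(** * The potential of the Cantor measure *)

Lemma jcont_xi (n i : nat) (lam c C : R) (xi : stream -> pt) (x : pt) (b : stream) :
  cantor_param n lam c C xi -> 0 < lam < 1 -> 0 < C -> (i < n)%nat ->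
  jcont n (fun _ b => xi b i) x b.
Proof.
  intros (_ & Hup & _) Hl HC Hi eps He.
  destruct (pow_small lam C eps) as [m Hm]; [lra|easy|easy|].
  exists 1. split; [lra|]. exists m. intros y b' _ Hb.
  rewrite Rabs_minus_sym. apply Rle_lt_trans with (1 := coord_le_dist n i _ _ Hi).
  apply Rle_lt_trans with (2 := Hm). now apply Hup.
Qed.

Lemma jcont_normsq (n : nat) (x : pt) (b : stream) : jcont n (fun y _ => normsq n y) x b.
Proof.
  unfold normsq. apply (jcont_sumR n n (fun i y _ => y i * y i)). intros i Hi.
  now apply jcont_mult; apply jcont_coord.
Qed.

Lemma jcont_kernels (n : nat) (lam c C h kap : R) (xi : stream -> pt) (x : pt) (b : stream) :
  cantor_param n lam c C xi -> 0 < lam < 1 -> 0 < C -> Ball n x ->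
  jcont n (fun x b => ker0 n h kap (xi b) x) x b /\
  (forall i, (i < n)%nat -> jcont n (fun x b => ker1 n h kap (xi b) i x) x b) /\
  (forall i j, (i < n)%nat -> (j < n)%nat -> jcont n (fun x b => ker2 n h kap (xi b) i j x) x b).
Proof.
  intros Hxi Hl HC Hx.
  pose proof (dist2_pos n x (xi b) Hx (proj1 Hxi b)) as Hr.
  assert (Hq : 0 < 1 - normsq n x) by (destruct Hx; lra).
  assert (Jq : jcont n (fun y _ => 1 - normsq n y) x b)
    by (apply jcont_plus; [apply jcont_const|apply jcont_opp, jcont_normsq]).
  assert (Jd : forall i, (i < n)%nat -> jcont n (fun y b => y i - xi b i) x b).
  { intros i Hi. apply jcont_plus; [now apply jcont_coord|apply jcont_opp].
    now apply (jcont_xi n i lam c C). }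
  assert (Jr : jcont n (fun y b => normsq n (fun k => y k - xi b k)) x b).
  { apply (jcont_sumR n n (fun i y b => (y i - xi b i) * (y i - xi b i))). intros i Hi.
    now apply jcont_mult; apply Jd. }
  assert (Jqi : jcont n (fun y _ => / (1 - normsq n y)) x b) by (apply jcont_inv; [lra|exact Jq]).
  assert (Jri : jcont n (fun y b => / normsq n (fun k => y k - xi b k)) x b)
    by (apply jcont_inv; [lra|exact Jr]).
  assert (JL : jcont n (fun y b => log_kernel n (xi b) y) x b).
  { apply jcont_plus; [apply jcont_ln; [lra|exact Jq]|apply jcont_opp, jcont_ln; [lra|exact Jr]]. }
  assert (Jlin : forall a d, jcont n (fun y b => exp (h * log_kernel n (xi b) y)
    * (a * log_kernel n (xi b) y + d)) x b).
  { intros a d. apply jcont_mult.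
    - apply jcont_exp, jcont_mult; [apply jcont_const|exact JL].
    - apply jcont_plus; [apply jcont_mult; [apply jcont_const|exact JL]|apply jcont_const]. }
  assert (Jdl : forall i, (i < n)%nat -> jcont n (fun y b => dlog n (xi b) i y) x b).
  { intros i Hi. unfold dlog. apply jcont_plus.
    - apply jcont_mult; [|exact Jqi]. apply jcont_opp, jcont_mult; [apply jcont_const|now apply jcont_coord].
    - apply jcont_opp, jcont_mult; [|exact Jri]. apply jcont_mult; [apply jcont_const|now apply Jd]. }
  split; [|split].
  - unfold ker0. apply jcont_mult.
    + apply jcont_exp, jcont_mult; [apply jcont_const|exact JL].
    + apply jcont_plus; [exact JL|apply jcont_const].
  - intros i Hi. unfold ker1. apply jcont_mult; [apply Jlin|now apply Jdl].
  - intros i j Hi Hj. unfold ker2. apply jcont_plus; apply jcont_mult; try apply Jlin.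
    + apply jcont_mult; now apply Jdl.
    + unfold ddlog. apply jcont_plus; [apply jcont_plus; [apply jcont_plus|]|].
      * apply jcont_mult; [apply jcont_const|exact Jqi].
      * apply jcont_opp, jcont_mult; [|now apply jcont_mult].
        apply jcont_mult; [apply jcont_mult; [apply jcont_const|]|]; now apply jcont_coord.
      * apply jcont_opp, jcont_mult; [apply jcont_const|exact Jri].
      * apply jcont_mult; [|now apply jcont_mult].
        apply jcont_mult; [apply jcont_mult; [apply jcont_const|]|]; now apply Jd.
Qed.

Definition potential (n : nat) (h kap : R) (xi : stream -> pt) (x : pt) : R :=
  mean (fun b => ker0 n h kap (xi b) x).

Definition potential1 (n : nat) (h kap : R) (xi : stream -> pt) (i : nat) (x : pt) : R :=
  mean (fun b => ker1 n h kap (xi b) i x).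

Definition potential2 (n : nat) (h kap : R) (xi : stream -> pt) (i j : nat) (x : pt) : R :=
  mean (fun b => ker2 n h kap (xi b) i j x).

Lemma ucont_kernels (n : nat) (lam c C h kap : R) (xi : stream -> pt) (x : pt) :
  cantor_param n lam c C xi -> 0 < lam < 1 -> 0 < C -> Ball n x ->
  ucont (fun b => ker0 n h kap (xi b) x) /\
  (forall i, (i < n)%nat -> ucont (fun b => ker1 n h kap (xi b) i x)) /\
  (forall i j, (i < n)%nat -> (j < n)%nat -> ucont (fun b => ker2 n h kap (xi b) i j x)).
Proof.
  intros Hxi Hl HC Hx.
  pose proof (fun b => jcont_kernels n lam c C h kap xi x b Hxi Hl HC Hx) as H.
  split; [|split].
  - apply (jcont_ucont n (fun x b => ker0 n h kap (xi b) x)). apply H.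
  - intros i Hi. apply (jcont_ucont n (fun x b => ker1 n h kap (xi b) i x)).
    intros b. now apply H.
  - intros i j Hi Hj. apply (jcont_ucont n (fun x b => ker2 n h kap (xi b) i j x)).
    intros b. now apply H.
Qed.

Lemma potential_C2 (n : nat) (lam c C h kap : R) (xi : stream -> pt) :
  cantor_param n lam c C xi -> 0 < lam < 1 -> 0 < C ->
  C2_on n (Ball n) (potential n h kap xi) (potential1 n h kap xi) (potential2 n h kap xi).
Proof.
  intros Hxi Hl HC.
  pose proof (fun x Hx b => jcont_kernels n lam c C h kap xi x b Hxi Hl HC Hx) as J.
  pose proof (fun x Hx => ucont_kernels n lam c C h kap xi x Hxi Hl HC Hx) as U.
  pose proof (proj1 Hxi) as HS.
  split; [|split; [|split; [|split]]].
  - intros i Hi x Hx. apply (has_partial_mean n i (fun x b => ker0 n h kap (xi b) x)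
      (fun x b => ker1 n h kap (xi b) i x)); try easy.
    + intros y Hy b. now apply has_partial_ker0.
    + intros y Hy. now apply U.
    + intros b. now apply J.
  - intros i j Hi Hj x Hx. apply (has_partial_mean n j (fun x b => ker1 n h kap (xi b) i x)
      (fun x b => ker2 n h kap (xi b) i j x)); try easy.
    + intros y Hy b. now apply has_partial_ker1.
    + intros y Hy. now apply U.
    + intros b. now apply J.
  - apply (continuous_on_mean n (fun x b => ker0 n h kap (xi b) x)). intros; now apply J.
  - intros i Hi. apply (continuous_on_mean n (fun x b => ker1 n h kap (xi b) i x)).
    intros; now apply J.
  - intros i j Hi Hj. apply (continuous_on_mean n (fun x b => ker2 n h kap (xi b) i j x)).
    intros; now apply J.
Qed.

Lemma hyp_laplacian_mean (n : nat) (D1 : nat -> pt -> R) (D2 : nat -> nat -> pt -> R) (k1 : stream -> nat -> pt -> R)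
  (k2 : stream -> nat -> nat -> pt -> R) (x : pt) :
  (forall i, (i < n)%nat -> ucont (fun b => k1 b i x) /\ D1 i x = mean (fun b => k1 b i x)) ->
  (forall i, (i < n)%nat -> ucont (fun b => k2 b i i x) /\ D2 i i x = mean (fun b => k2 b i i x)) ->
  hyp_laplacian n D1 D2 x = mean (fun b => hyp_laplacian n (k1 b) (k2 b) x).
Proof.
  intros H1 H2. unfold hyp_laplacian. cbv zeta.
  rewrite (mean_lin _ _ (fun b => sumR n (fun i => k2 b i i x))
    (fun b => sumR n (fun i => x i * k1 b i x))).
  - rewrite (mean_sumR n (fun i b => k2 b i i x)) by (intros; now apply H2).
    rewrite (mean_sumR n (fun i b => x i * k1 b i x)).
    + f_equal; f_equal; apply sumR_ext; intros i Hi; [now apply H2|].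
      destruct (H1 i Hi) as [U E]. rewrite E.
      transitivity (mean (fun b => x i * k1 b i x + 0 * k1 b i x)).
      * rewrite mean_lin by easy. ring.
      * f_equal. apply functional_extensionality; intros; ring.
    + intros i Hi. destruct (H1 i Hi) as [U _].
      replace (fun b => x i * k1 b i x) with (fun b => x i * k1 b i x + 0 * k1 b i x)
        by (apply functional_extensionality; intros; ring).
      now apply ucont_lin.
  - apply (ucont_sumR n (fun i b => k2 b i i x)). intros; now apply H2.
  - apply (ucont_sumR n (fun i b => x i * k1 b i x)). intros i Hi. destruct (H1 i Hi) as [U _].
    replace (fun b => x i * k1 b i x) with (fun b => x i * k1 b i x + 0 * k1 b i x)
      by (apply functional_extensionality; intros; ring).
    now apply ucont_lin.
Qed.

Lemma potential_harmonic (n : nat) (lam c C kap : R) (xi : stream -> pt) (x : pt) :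
  cantor_param n lam c C xi -> 0 < lam < 1 -> 0 < C -> Ball n x ->
  let h := (INR n - 1) / 2 in
  - hyp_laplacian n (potential1 n h kap xi) (potential2 n h kap xi) x
  = (INR n - 1) ^ 2 / 4 * potential n h kap xi x.
Proof.
  intros Hxi Hl HC Hx h.
  destruct (ucont_kernels n lam c C h kap xi x Hxi Hl HC Hx) as (U0 & U1 & U2).
  rewrite (hyp_laplacian_mean n _ _
    (fun b => ker1 n h kap (xi b)) (fun b => ker2 n h kap (xi b)))
    by (intros; split; [auto|reflexivity]).
  replace (fun b => hyp_laplacian n (ker1 n h kap (xi b)) (ker2 n h kap (xi b)) x)
    with (fun b => - (h * h) * ker0 n h kap (xi b) x + 0 * ker0 n h kap (xi b) x).
  - rewrite mean_lin by easy. unfold potential, h. field.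
  - apply functional_extensionality. intros b. unfold h.
    rewrite ker_laplacian by (easy || apply Hxi). ring.
Qed.

(** * Boundedness from above *)

(** Equal to w^j, where j is the length of the common prefix of [b0] and [b], capped at T. The
    recursion on the first bit matches that of [avg]. *)
Fixpoint gap (T : nat) (w : R) (b0 b : stream) : R :=
  match T with
  | O => 1
  | S T => if Bool.eqb (b0 O) (b O) then w * gap T w (fun k => b0 (S k)) (fun k => b (S k)) else 1
  end.

Lemma gap_eq (T : nat) (w : R) (b0 b : stream) : exists j, (j <= T)%nat /\ agree j b0 b /\
  (j = T \/ b0 j <> b j) /\ gap T w b0 b = w ^ j.
Proof.
  revert b0 b. induction T as [|T IH]; intros b0 b; simpl.
  - exists O. repeat split; [lia|intros j; lia|now left].
  - destruct (Bool.eqb (b0 O) (b O)) eqn:E.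
    + apply Bool.eqb_prop in E.
      destruct (IH (fun k => b0 (S k)) (fun k => b (S k))) as (j & Hj & Ha & Hne & Hg).
      exists (S j). repeat split; [lia| |destruct Hne; [left; lia|now right]|simpl; now rewrite Hg].
      intros [|i] Hi; [easy|]. apply (Ha i). lia.
    + exists O. repeat split; [lia|intros j; lia|right; now apply Bool.eqb_false_iff].
Qed.

(** Half of the streams leave [b0] at the first bit, so the average obeys E_(T+1) = 1/2 + (w/2) E_T.
    For w < 2 it stays bounded independently of T. *)
Lemma avg_gap (T M : nat) (w : R) (b0 : stream) : 0 < w < 2 -> (T <= M)%nat ->
  avg M (gap T w b0) <= / (1 - w / 2).
Proof.
  intros Hw. set (K := / (1 - w / 2)).
  assert (HK : K * (1 - w / 2) = 1) by (apply Rinv_l; lra).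
  assert (HK1 : 0 < K) by (apply Rinv_0_lt_compat; lra).
  revert b0 M. induction T as [|T IH]; intros b0 M HM.
  - simpl. replace (avg M (fun _ => 1)) with 1 by (now rewrite avg_const). nra.
  - destruct M as [|M]; [lia|]. specialize (IH (fun k => b0 (S k)) M ltac:(lia)).
    assert (E : avg (S M) (gap (S T) w b0) = 1 / 2 + w / 2 * avg M (gap T w (fun k => b0 (S k)))).
    { assert (E1 : avg M (fun b => w * gap T w (fun k => b0 (S k)) b)
        = w * avg M (gap T w (fun k => b0 (S k)))).
      { transitivity (avg M (fun b => w * gap T w (fun k => b0 (S k)) b + 0 * gap T w (fun k => b0 (S k)) b)).
        - f_equal. apply functional_extensionality; intros; ring.
        - rewrite avg_lin. ring. }
      simpl. destruct (b0 O); simpl; rewrite avg_const;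
        change (fun b : stream => w * gap T w (fun k => b0 (S k)) (fun k => b k))
          with (fun b : stream => w * gap T w (fun k => b0 (S k)) b); rewrite E1; field. }
    rewrite E. nra.
Qed.

(** Otherwise values could be halved indefinitely and would drop below m. It supplies a point of the
    Cantor set nearest to x up to a factor 2. *)
Lemma exists_near_minimizer (f : stream -> R) (m : R) : 0 < m -> (forall b, m <= f b) ->
  exists b0, forall b, f b0 <= 2 * f b.
Proof.
  intros Hm Hf. apply NNPP. intros Hno.
  assert (Hstep : forall b0, exists b, 2 * f b < f b0).
  { intros b0. apply NNPP. intros H. apply Hno. exists b0. intros b.
    apply Rnot_lt_le. intros Hb. apply H. now exists b. }
  set (z := fun _ : nat => false).
  assert (Hk : forall k, exists b, f b <= f z * (1 / 2) ^ k).
  { induction k as [|k [b Hb]]; [exists z; simpl; lra|].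
    destruct (Hstep b) as [b' Hb']. exists b'. simpl. lra. }
  destruct (pow_small (1 / 2) (f z) m) as [k Hk']; [lra|pose proof (Hf z); lra|easy|].
  destruct (Hk k) as [b Hb]. pose proof (Hf b). lra.
Qed.

Lemma ker0_le_exp (n : nat) (h kap : R) (xi x : pt) : 0 < kap ->
  ker0 n h kap xi x <= kap * exp ((h + / kap) * log_kernel n xi x).
Proof.
  intros Hk. unfold ker0. set (L := log_kernel n xi x).
  replace ((h + / kap) * L) with (h * L + L / kap) by (field; lra).
  rewrite exp_plus.
  pose proof (exp_ineq1_le (L / kap)) as H.
  apply Rmult_le_compat_l with (r := kap) in H; [|lra].
  replace (kap * (1 + L / kap)) with (L + kap) in H by (field; lra).
  pose proof (exp_pos (h * L)). nra.
Qed.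

Lemma log_kernel_le (n : nat) (xi x : pt) (B : R) : Ball n x -> Sphere n xi ->
  2 <= B * dist n x xi -> log_kernel n xi x <= ln B.
Proof.
  intros Hx Hxi HB. pose proof (dist2_pos n x xi Hx Hxi) as Hr.
  assert (Hq : 0 < 1 - normsq n x) by (destruct Hx; lra).
  pose proof (dist_Sphere_ge n x xi ltac:(lra) Hxi) as Hd.
  assert (HD : 0 < dist n x xi) by lra.
  unfold log_kernel. rewrite <- dist_sqr in *.
  rewrite <- ln_div by easy. set (D := dist n x xi) in *.
  assert (Hdiv : (1 - normsq n x) / (D * D) <= B).
  { apply Rmult_le_reg_r with (D * D); [easy|].
    replace (_ / _ * _) with (1 - normsq n x) by (field; lra). nra. }
  assert (0 < (1 - normsq n x) / (D * D)) by now apply Rdiv_lt_0_compat.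
  destruct Hdiv as [Hlt|Heq]; [left; now apply ln_increasing|right; now rewrite Heq].
Qed.

(** Let b0 be almost nearest to x. If b leaves b0 at index j, then c lam^j <= |xi b0 - xi b| <= 3 |x
    - xi b|, hence P^a <= (6/c)^a w^j with w = lam^-a. Now a < s means w < lam^-s = 2, and the
    average of w^j is bounded uniformly in x. *)
Lemma potential_bounded_above (n : nat) (lam c C h kap s : R) (xi : stream -> pt) :
  cantor_param n lam c C xi -> 0 < lam < 1 -> 0 < c -> 0 < C -> 0 < kap -> 0 < h ->
  Rpower lam s = 1 / 2 -> h + / kap < s ->
  exists M, forall x, Ball n x -> potential n h kap xi x <= M.
Proof.
  intros Hxi Hl Hc HC Hk Hh Hs Has. set (a := h + / kap) in *.
  assert (Ha : 0 < a) by (pose proof (Rinv_0_lt_compat kap Hk); unfold a; lra).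
  set (A := kap * exp (a * ln (6 / c))).
  assert (HA : 0 < A) by (apply Rmult_lt_0_compat; [easy|apply exp_pos]).
  set (w := exp (- (a * ln lam))).
  assert (Hw : 0 < w < 2).
  { split; [apply exp_pos|].
    assert (E : exp (- (s * ln lam)) = 2).
    { rewrite exp_Ropp. fold (Rpower lam s). rewrite Hs. field. }
    rewrite <- E. apply exp_increasing.
    assert (ln lam < 0) by (rewrite <- ln_1; apply ln_increasing; lra). nra. }
  exists (A * / (1 - w / 2)). intros x Hx.
  assert (Hq : 0 < 1 - normsq n x) by (destruct Hx; lra).
  set (q := 1 - normsq n x) in *.
  assert (HD : forall b, q / 2 <= dist n x (xi b)).
  { intros b. pose proof (dist_Sphere_ge n x (xi b) ltac:(unfold q in Hq; lra) (proj1 Hxi b)).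
    unfold q. lra. }
  destruct (exists_near_minimizer (fun b => dist n x (xi b)) (q / 2)) as [b0 Hb0]; [lra|easy|].
  (* Beyond depth T agreement with b0 gives nothing more, since |x - xi b| >= q/2 already; T is
     chosen so that c lam^T < 3q/2. *)
  destruct (pow_small lam (2 * c / 3) q) as [T HT]; [lra|lra|easy|].
  apply (mean_le_eventually _ _ T); [now apply (ucont_kernels n lam c C)|].
  intros p Hp.
  apply Rle_trans with (avg p (fun b => A * gap T w b0 b + 0 * gap T w b0 b)).
  - apply avg_le. intros b.
    destruct (gap_eq T w b0 b) as (j & Hj & Ha' & Hne & ->).
    apply Rle_trans with (1 := ker0_le_exp n h kap (xi b) x Hk). fold a.
    assert (Hlj : 0 < lam ^ j) by (apply pow_lt; lra).
    (* The 6 is the 3 of the triangle inequality times the 2 in P <= 2/|x - xi|. *)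
    assert (H6 : 2 <= 6 / (c * lam ^ j) * dist n x (xi b)).
    { apply Rmult_le_reg_l with (c * lam ^ j / 2); [nra|].
      replace (c * lam ^ j / 2 * (6 / (c * lam ^ j) * dist n x (xi b)))
        with (3 * dist n x (xi b)) by (field; split; lra).
      destruct Hne as [->|Hne].
      - pose proof (HD b). lra.
      - destruct Hxi as (_ & _ & Hlo). pose proof (Hlo j b0 b Ha' Hne).
        pose proof (dist_triangle n (xi b0) x (xi b)). rewrite (dist_sym n (xi b0) x) in *.
        pose proof (Hb0 b). lra. }
    apply (log_kernel_le n (xi b) x _ Hx (proj1 Hxi b)) in H6.
    replace (6 / (c * lam ^ j)) with (6 / c * / lam ^ j) in H6 by (field; split; lra).
    rewrite ln_mult, ln_Rinv, ln_pow in H6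
      by (try apply Rdiv_lt_0_compat; try apply Rinv_0_lt_compat; lra).
    assert (E : w ^ j = exp (a * (- (INR j * ln lam)))).
    { rewrite <- Rpower_pow by apply exp_pos. unfold Rpower, w. rewrite ln_exp. f_equal. ring. }
    rewrite E. unfold A. rewrite Rmult_0_l, Rplus_0_r, Rmult_assoc, <- exp_plus.
    apply Rmult_le_compat_l; [lra|].
    assert (Hle : a * log_kernel n (xi b) x <= a * ln (6 / c) + a * - (INR j * ln lam)) by nra.
    destruct Hle as [Hlt| ->]; [left; now apply exp_increasing|lra].
  - rewrite avg_lin, Rmult_0_l, Rplus_0_r. apply Rmult_le_compat_l; [lra|]. now apply avg_gap.
Qed.

Lemma potential_positive_near (n : nat) (lam c C h kap : R) (xi : stream -> pt) (x : pt) :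
  cantor_param n lam c C xi -> 0 < lam < 1 -> 0 < C -> Sphere n x ->
  (forall r, 0 < r -> exists y, Ball n y /\ 0 < potential n h kap xi y /\ dist n x y < r) ->
  near n xi x.
Proof.
  intros Hxi Hl HC Hx Hcl eps He. apply NNPP. intros Hno.
  assert (Hfar : forall b, eps <= dist n x (xi b)).
  { intros b. apply Rnot_lt_le. intros H. apply Hno. now exists b. }
  (* The first bound keeps y at distance at least eps/2 from the Cantor set; the second gives 1 -
     |y|^2 <= 2 eta <= e^(-kap) eps^2/4, hence P <= e^(-kap) and a kernel that is nowhere
     positive. *)
  set (eta := Rmin (eps / 2) (exp (- kap) * (eps * eps) / 8)).
  assert (Heta : 0 < eta).
  { apply Rmin_glb_lt; [lra|]. pose proof (exp_pos (- kap)). apply Rdiv_lt_0_compat; [|lra].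
    apply Rmult_lt_0_compat; nra. }
  destruct (Hcl eta Heta) as (y & Hy & Hpos & Hxy).
  assert (H1 : eta <= eps / 2) by apply Rmin_l.
  assert (H2 : eta <= exp (- kap) * (eps * eps) / 8) by apply Rmin_r.
  apply (Rlt_not_le _ _ Hpos). apply mean_le_const; [now apply (ucont_kernels n lam c C)|].
  intros b. pose proof (proj1 Hxi b) as HS.
  pose proof (dist2_pos n y (xi b) Hy HS) as Hr.
  assert (Hq : 0 < 1 - normsq n y) by (destruct Hy; lra).
  pose proof (dist_Sphere_ge n y x ltac:(lra) Hx) as Hqd. rewrite dist_sym in Hqd.
  assert (HL : log_kernel n (xi b) y <= - kap).
  { unfold log_kernel. rewrite <- ln_div, <- (ln_exp (- kap)) by easy.
    apply Rcomplements.ln_le; [now apply Rdiv_lt_0_compat|].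
    apply Rmult_le_reg_r with (normsq n (fun k => y k - xi b k)); [easy|].
    replace (_ / _ * _) with (1 - normsq n y) by (field; lra).
    rewrite <- dist_sqr.
    pose proof (dist_triangle n x y (xi b)). pose proof (Hfar b).
    assert (Hd : eps / 2 <= dist n y (xi b)) by lra.
    assert (eps * eps / 4 <= dist n y (xi b) * dist n y (xi b)) by nra.
    pose proof (exp_pos (- kap)).
    assert (exp (- kap) * (eps * eps / 4) <= exp (- kap) * (dist n y (xi b) * dist n y (xi b)))
      by (apply Rmult_le_compat_l; lra).
    lra. }
  unfold ker0. pose proof (exp_pos (h * log_kernel n (xi b) y)). nra.
Qed.

(** At the centre P = 1 for every xi. This provides the point where the positive part is nonzero. *)
Lemma potential_at_0 (n : nat) (h kap : R) (xi : stream -> pt) :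
  (forall b, Sphere n (xi b)) -> potential n h kap xi (fun _ => 0) = kap.
Proof.
  intros HS. unfold potential. transitivity (mean (fun _ => kap)); [f_equal|apply mean_const].
  apply functional_extensionality. intros b. unfold ker0, log_kernel.
  assert (E0 : normsq n (fun _ => 0) = 0)
    by (unfold normsq; rewrite sumR_const; ring).
  assert (E1 : normsq n (fun k => 0 - xi b k) = 1).
  { transitivity (normsq n (xi b)); [apply sumR_ext; intros; ring|apply HS]. }
  rewrite E0, E1, Rminus_0_r, ln_1, Rminus_0_r, Rmult_0_r, exp_0. ring.
Qed.

(** * The domain *)

(** A union of nontangential approach regions: it contains the radii ending in the Cantor set, and
    the bound forces its accumulation points on the sphere into the closure of that set. *)
Definition cone (n : nat) (xi : stream -> pt) (x : pt) : Prop :=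
  Ball n x /\ exists b, dist n x (xi b) < 2 * (1 - normsq n x).

(* The cone over the Cantor set is added (where u <= 0, and u is replaced by 0 there) to force
   every point of the Cantor set into the closure of the domain. *)
Definition domain (n : nat) (xi : stream -> pt) (u : pt -> R) (x : pt) : Prop :=
  Ball n x /\ (0 < u x \/ exists r, 0 < r /\
    forall y, InR n y -> dist n x y < r -> cone n xi y /\ u y <= 0).

Definition pos_ind (u : pt -> R) (x : pt) : R := if Rlt_dec 0 (u x) then 1 else 0.

Lemma cone_open (n : nat) (xi : stream -> pt) (x : pt) : cone n xi x ->
  exists r, 0 < r /\ forall y, InR n y -> dist n x y < r -> cone n xi y.
Proof.
  intros [Hx [b Hb]]. set (g := 2 * (1 - normsq n x) - dist n x (xi b)).
  destruct (Ball_open n x Hx) as [r [Hr HB]].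
  destruct (jcont_normsq n x b (g / 3)) as [d [Hd [m H]]]; [unfold g; lra|].
  assert (Hg : 0 < g / 3) by (unfold g; lra).
  exists (Rmin r (Rmin d (g / 3))). split; [repeat apply Rmin_glb_lt; easy|].
  intros y Hy Hxy.
  pose proof (Rmin_l r (Rmin d (g / 3))). pose proof (Rmin_r r (Rmin d (g / 3))).
  pose proof (Rmin_l d (g / 3)). pose proof (Rmin_r d (g / 3)).
  split; [apply HB; [easy|lra]|]. exists b.
  specialize (H y b ltac:(lra) ltac:(now intros j _)). apply Rabs_lt_between in H.
  pose proof (dist_triangle n y x (xi b)) as Ht. rewrite (dist_sym n y x) in Ht.
  unfold g in *. lra.
Qed.

(** The two pieces, {u > 0} and an interior part of {u <= 0}, are disjoint open sets, so [pos_ind u]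
    is locally constant on the domain. The kink of the positive part lies outside the domain. *)
Lemma domain_open_aux (n : nat) (xi : stream -> pt) (u : pt -> R) (x : pt) :
  continuous_on n (Ball n) u -> domain n xi u x ->
  exists r, 0 < r /\ forall y, InR n y -> dist n x y < r ->
    domain n xi u y /\ pos_ind u y = pos_ind u x.
Proof.
  intros Hc [Hx [Hpos|[r [Hr H]]]].
  - destruct (Ball_open n x Hx) as [r [Hr HB]].
    destruct (Hc x Hx (u x) Hpos) as [d [Hd H]].
    exists (Rmin r d). split; [now apply Rmin_glb_lt|]. intros y Hy Hxy.
    assert (HBy : Ball n y) by (apply HB; [easy|exact (Rlt_le_trans _ _ _ Hxy (Rmin_l _ _))]).
    specialize (H y HBy (Rlt_le_trans _ _ _ Hxy (Rmin_r _ _))). apply Rabs_lt_between in H.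
    split; [split; [easy|left; lra]|]. unfold pos_ind. do 2 destruct Rlt_dec; lra.
  - exists r. split; [easy|]. intros y Hy Hxy.
    destruct (H y Hy Hxy) as [[HBy _] Huy].
    destruct (H x (proj1 Hx) ltac:(now rewrite dist_refl)) as [_ Hux].
    split; [|unfold pos_ind; do 2 destruct Rlt_dec; lra].
    split; [easy|right]. exists (r - dist n x y). split; [lra|]. intros z Hz Hyz.
    apply H; [easy|]. pose proof (dist_triangle n x y z). lra.
Qed.

Lemma domain_open (n : nat) (xi : stream -> pt) (u : pt -> R) :
  continuous_on n (Ball n) u -> open_in_H n (domain n xi u).
Proof.
  intros Hc. split; [now intros x [Hx _]|]. intros x Hx.
  destruct (domain_open_aux n xi u x Hc Hx) as [r [Hr H]]. exists r. split; [easy|].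
  intros; now apply H.
Qed.

(** Take y on the radius to [xi b]. Either points with u > 0 lie close to y, or u <= 0 on a
    neighbourhood of y inside the cone and y itself is in the domain. The sign of u near the Cantor
    set is never decided. *)
Lemma cantor_in_asymp_boundary (n : nat) (xi : stream -> pt) (u : pt -> R) (b : stream) :
  (forall b, Sphere n (xi b)) -> asymp_boundary n (domain n xi u) (xi b).
Proof.
  intros HS. destruct (HS b) as [HI H1]. split; [easy|]. split; [easy|]. intros eps He.
  set (t := Rmin (1 / 2) (eps / 2)).
  assert (Ht : 0 < t <= 1 / 2) by (split; [apply Rmin_glb_lt; lra|apply Rmin_l]).
  assert (Hte : t <= eps / 2) by apply Rmin_r.
  set (y := fun i => (1 - t) * xi b i).
  assert (Hy : normsq n y = (1 - t) * (1 - t)).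
  { transitivity ((1 - t) * (1 - t) * normsq n (xi b)); [|rewrite H1; ring].
    unfold normsq. rewrite <- sumR_scal. apply sumR_ext; intros; unfold y; ring. }
  assert (Hd : dist n y (xi b) = t).
  { unfold dist. replace (normsq n _) with (t * t); [apply sqrt_square; lra|].
    transitivity (t * t * normsq n (xi b)); [rewrite H1; ring|].
    unfold normsq. rewrite <- sumR_scal. apply sumR_ext; intros; unfold y; ring. }
  assert (HIy : InR n y) by (intros i Hi; unfold y; rewrite HI by easy; ring).
  assert (HBy : Ball n y) by (split; [easy|rewrite Hy; nra]).
  assert (Hcone : cone n xi y) by (split; [easy|exists b; rewrite Hd, Hy; nra]).
  destruct (cone_open n xi y Hcone) as [r [Hr Hopen]].
  assert (Hr' : 0 < Rmin r (eps / 2)) by (apply Rmin_glb_lt; lra).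
  destruct (classic (exists z, InR n z /\ dist n y z < Rmin r (eps / 2) /\ 0 < u z))
    as [(z & Hz & Hyz & Hpos)|Hno].
  - exists z. pose proof (Rmin_l r (eps / 2)). pose proof (Rmin_r r (eps / 2)). split.
    + split; [|now left]. apply (Hopen z Hz). lra.
    + pose proof (dist_triangle n (xi b) y z) as H3. rewrite (dist_sym n (xi b) y), Hd in H3. lra.
  - exists y. split; [|rewrite dist_sym, Hd; lra]. split; [easy|right].
    exists (Rmin r (eps / 2)). split; [easy|]. intros z Hz Hyz. split.
    + apply (Hopen z Hz). exact (Rlt_le_trans _ _ _ Hyz (Rmin_l _ _)).
    + apply Rnot_lt_le. intros Hpos. apply Hno. now exists z.
Qed.

Lemma asymp_boundary_near_cantor (n : nat) (xi : stream -> pt) (u : pt -> R) (x : pt) :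
  (Sphere n x ->
   (forall r, 0 < r -> exists y, Ball n y /\ 0 < u y /\ dist n x y < r) -> near n xi x) ->
  asymp_boundary n (domain n xi u) x -> near n xi x.
Proof.
  intros Hpos [HS [_ Hcl]].
  destruct (classic (forall r, 0 < r -> exists y, Ball n y /\ 0 < u y /\ dist n x y < r))
    as [H|H]; [now apply Hpos|].
  apply not_all_ex_not in H. destruct H as [r H]. apply imply_to_and in H. destruct H as [Hr Hno].
  intros eps He.
  (* For y in the cone, |y - xi b| < 2(1 - |y|^2) <= 4 |x - y|; adding |x - y| gives the factor
     5. *)
  destruct (Hcl (Rmin r (eps / 5))) as [y [[HBy [Hu|[d [Hd H]]]] Hxy]]; [apply Rmin_glb_lt; lra| |].
  - exfalso. apply Hno. exists y. repeat split; try easy; try apply HBy.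
    exact (Rlt_le_trans _ _ _ Hxy (Rmin_l _ _)).
  - destruct (H y (proj1 HBy) ltac:(now rewrite dist_refl)) as [[_ [b Hb]] _].
    exists b. pose proof (Rmin_r r (eps / 5)).
    pose proof (dist_Sphere_ge n y x ltac:(destruct HBy; lra) HS) as Hq. rewrite dist_sym in Hq.
    pose proof (dist_triangle n x y (xi b)). lra.
Qed.

(** * Passage to the positive part *)

Lemma continuous_on_pos_ind (n : nat) (xi : stream -> pt) (u f : pt -> R) :
  continuous_on n (Ball n) u -> continuous_on n (Ball n) f ->
  continuous_on n (domain n xi u) (fun x => pos_ind u x * f x).
Proof.
  intros Hu Hf x Hx eps He.
  destruct (domain_open_aux n xi u x Hu Hx) as [r [Hr H]].
  destruct (Hf x (proj1 Hx) eps He) as [d [Hd Hfd]].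
  exists (Rmin r d). split; [now apply Rmin_glb_lt|]. intros y [HBy _] Hxy.
  destruct (H y (proj1 HBy) (Rlt_le_trans _ _ _ Hxy (Rmin_l _ _))) as [_ ->].
  specialize (Hfd y HBy (Rlt_le_trans _ _ _ Hxy (Rmin_r _ _))).
  unfold pos_ind. destruct Rlt_dec.
  - now rewrite !Rmult_1_l.
  - now rewrite !Rmult_0_l, Rminus_diag, Rabs_R0.
Qed.

Lemma has_partial_pos_ind (n i : nat) (xi : stream -> pt) (u f : pt -> R) (x : pt) (l : R) :
  (i < n)%nat -> continuous_on n (Ball n) u -> domain n xi u x -> has_partial f i x l ->
  has_partial (fun x => pos_ind u x * f x) i x (pos_ind u x * l).
Proof.
  intros Hi Hu Hx Hf eps He.
  destruct (domain_open_aux n xi u x Hu Hx) as [r [Hr H]].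
  destruct (Hf eps He) as [d Hfd].
  exists (mkposreal (Rmin r d) (Rmin_glb_lt _ _ _ Hr (cond_pos d))). simpl. intros t Ht0 Ht.
  assert (Ht1 : Rabs t < r) by exact (Rlt_le_trans _ _ _ Ht (Rmin_l _ _)).
  assert (Ht2 : Rabs t < d) by exact (Rlt_le_trans _ _ _ Ht (Rmin_r _ _)).
  specialize (Hfd t Ht0 Ht2). rewrite Rplus_0_l, shift_0 in *.
  destruct (H (shift x i t) (InR_shift n i x t Hi (proj1 (proj1 Hx)))
    ltac:(now rewrite dist_shift)) as [_ ->].
  unfold pos_ind. destruct Rlt_dec.
  - now rewrite !Rmult_1_l.
  - replace (_ - _) with 0 by (field; easy). now rewrite Rabs_R0.
Qed.

Lemma continuous_on_pos_part (n : nat) (A : pt -> Prop) (u : pt -> R) :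
  continuous_on n A u -> continuous_on n A (fun x => pos_ind u x * u x).
Proof.
  intros Hu x Hx eps He. destruct (Hu x Hx eps He) as [d [Hd H]].
  exists d. split; [easy|]. intros y Hy Hxy. specialize (H y Hy Hxy).
  apply Rabs_lt_between in H. unfold pos_ind.
  do 2 destruct Rlt_dec; apply Rabs_def1; lra.
Qed.

Lemma hyp_laplacian_scal (n : nat) (p : pt -> R) (D1 : nat -> pt -> R)
  (D2 : nat -> nat -> pt -> R) (x : pt) :
  hyp_laplacian n (fun i x => p x * D1 i x) (fun i j x => p x * D2 i j x) x
  = p x * hyp_laplacian n D1 D2 x.
Proof.
  unfold hyp_laplacian. cbv zeta. rewrite sumR_scal.
  rewrite (sumR_ext n (fun i => x i * (p x * D1 i x)) (fun i => p x * (x i * D1 i x)))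
    by (intros; ring).
  rewrite sumR_scal. ring.
Qed.

Theorem mainTheorem13 (n : nat) (s : R) :
  (2 <= n)%nat ->
  (INR n - 1) / 2 < s -> s < INR n - 1 ->
  exists (Omega : pt -> Prop),
    open_in_H n Omega /\
    hausdorff_dim n (asymp_boundary n Omega) s /\
    exists (u : pt -> R) (D1 : nat -> pt -> R) (D2 : nat -> nat -> pt -> R),
      continuous_on n (closure_H n Omega) u /\
      C2_on n Omega u D1 D2 /\
      (exists M, forall x, Omega x -> Rabs (u x) <= M) /\
      (exists x, Omega x /\ u x <> 0) /\
      (forall x, Omega x ->
         - hyp_laplacian n D1 D2 x = (INR n - 1) ^ 2 / 4 * u x) /\
      (forall x, boundary_H n Omega x -> u x = 0).
Proof.
  intros Hn Hs1 Hs2.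
  set (h := (INR n - 1) / 2) in *.
  assert (Hh : 0 < h) by (apply le_INR in Hn; simpl in Hn; unfold h; lra).
  destruct (exists_cantor_param n s Hn ltac:(lra) Hs2) as (lam & c & C & xi & Hl & Hls & Hc & HC & Hxi).
  pose proof (proj1 Hxi) as HS.
  (* Then 1/kap = (s - h)/2, and the exponent h + 1/kap is the midpoint of h and s. *)
  set (kap := 2 / (s - h)).
  assert (Hk : 0 < kap) by (apply Rdiv_lt_0_compat; lra).
  assert (Hki : h + / kap < s) by (unfold kap; rewrite Rinv_div; lra).
  set (u := potential n h kap xi).
  destruct (potential_C2 n lam c C h kap xi Hxi Hl HC) as (Hd1 & Hd2 & Hc0 & Hc1 & Hc2).
  fold u in Hd1, Hc0.
  destruct (potential_bounded_above n lam c C h kap s xi) as [M HM]; try easy.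
  fold u in HM.
  exists (domain n xi u). split; [now apply domain_open|]. split.
  { apply (hausdorff_dim_cantor n lam c C s xi); try easy; try lra.
    - intros b. now apply cantor_in_asymp_boundary.
    - intros x. apply asymp_boundary_near_cantor. intros Hx.
      now apply (potential_positive_near n lam c C h kap). }
  exists (fun x => pos_ind u x * u x), (fun i x => pos_ind u x * potential1 n h kap xi i x),
    (fun i j x => pos_ind u x * potential2 n h kap xi i j x).
  assert (HM0 : 0 < u (fun _ => 0)) by (unfold u; rewrite potential_at_0; easy).
  assert (HB0 : Ball n (fun _ => 0)).
  { split; [now intros i _|]. unfold normsq. rewrite sumR_const. lra. }
  split; [|split; [|split; [|split; [|split]]]].
  - apply continuous_on_pos_part. intros x Hx eps He.
    destruct (Hc0 x (proj1 Hx) eps He) as [d [Hd H]].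
    exists d. split; [easy|]. intros y Hy. apply H, Hy.
  - split; [|split; [|split; [|split]]].
    + intros i Hi x Hx. apply (has_partial_pos_ind n i xi u u); try easy. now apply Hd1; try apply Hx.
    + intros i j Hi Hj x Hx. apply (has_partial_pos_ind n j xi u (potential1 n h kap xi i)); try easy.
      now apply Hd2; try apply Hx.
    + now apply continuous_on_pos_ind.
    + intros i Hi. now apply continuous_on_pos_ind; try apply Hc1.
    + intros i j Hi Hj. now apply continuous_on_pos_ind; try apply Hc2.
  (* The value at the centre shows M > 0, which is what the points where the positive part vanishes
     require. *)
  - exists M. intros x [Hx _]. pose proof (HM x Hx). pose proof (HM _ HB0).
    unfold pos_ind. destruct Rlt_dec.
    + rewrite Rmult_1_l, Rabs_pos_eq; lra.
    + rewrite Rmult_0_l, Rabs_R0. lra.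
  - exists (fun _ => 0). split; [split; [easy|now left]|].
    unfold pos_ind. destruct Rlt_dec; lra.
  - intros x Hx. rewrite (hyp_laplacian_scal n (pos_ind u)).
    rewrite Ropp_mult_distr_r. unfold h. rewrite (potential_harmonic n lam c C) by (easy || apply Hx).
    unfold u, h. ring.
  (* A boundary point lies outside the domain, so u <= 0 there and the positive part vanishes. *)
  - intros x [[HBx _] Hx]. unfold pos_ind. destruct Rlt_dec; [|ring].
    exfalso. apply Hx. split; [easy|now left].
Qed.
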